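(* Let $M^5\subset\mathbb C^4$ be a maximally minimal CR-generic real analytic submanifold with frame $\{\overline{\mathcal S},\mathcal S,\mathcal T,\overline{\mathcal L},\mathcal L\}$ and fundamental functions $P,Q,R,A,B$. The coefficients of the two Lie brackets $$[\mathcal T,\mathcal S]=E\,\mathcal T+F\,\mathcal S+G\,\overline{\mathcal S},\qquad [\mathcal T,\overline{\mathcal S}]=\overline E\,\mathcal T+\overline G\,\mathcal S+\overline F\,\overline{\mathcal S}$$ are three complex-valued functions given by $$E=-i\overline{\mathcal L}(P)-iAQ-i\overline PR+i\mathcal L(A)+iBP+iA\overline B,$$ $$F=-i\overline{\mathcal L}(Q)-iR\overline R+iA+i\mathcal L(B)+iB\overline B,$$ $$G=-iP-i\overline BQ-iR\overline Q-i\overline{\mathcal L}(R)+iBR+i\overline B\,\overline B+i\mathcal L(\overline B),$$ while the coefficients of the bracket $[\mathcal S,\overline{\mathcal S}]=iJ\,\mathcal T+K\,\mathcal S-\overline K\,\overline{\mathcal S}$ are one complex-valued function $K$ and one real-valued function $J$ given by $$\begin{aligned}-2J={}&-\overline{\mathcal L}(\overline{\mathcal L}(P))+\overline{\mathcal L}(\mathcal L(A))+\mathcal L(\overline{\mathcal L}(A))-\mathcal L(\mathcal L(\overline P))\\&-Q\overline{\mathcal L}(A)-2A\overline{\mathcal L}(Q)-R\overline{\mathcal L}(\overline P)-2\overline P\,\overline{\mathcal L}(R)-2AR\overline R-2P\overline P-\overline B\,\overline PQ-\overline P\,\overline QR\\&-\overline R\mathcal L(P)-2P\mathcal L(\overline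 R)-\overline Q\mathcal L(A)-2A\mathcal L(\overline Q)-PQ\overline R-BP\overline Q\\&+2P\overline{\mathcal L}(B)+B\overline{\mathcal L}(P)+2A\overline{\mathcal L}(\overline B)+\overline B\,\overline{\mathcal L}(A)+2A\mathcal L(B)+2A^2+2AB\overline B+2\overline P\mathcal L(\overline B)\\&+B\overline PR+\overline B^2\overline P+B\mathcal L(A)+\overline B\mathcal L(\overline P)+B^2P+\overline BP\overline R,\end{aligned}$$ $$\begin{aligned}2iK={}&-\overline{\mathcal L}(\overline{\mathcal L}(Q))+\overline{\mathcal L}(\mathcal L(B))+\mathcal L(\overline{\mathcal L}(B))-\mathcal L(\mathcal L(\overline R))\\&-2\overline R\,\overline{\mathcal L}(R)-R\overline{\mathcal L}(\overline R)-B\overline{\mathcal L}(Q)-BR\overline R-2P\overline R-\overline QR\overline R-2\mathcal L(\overline P)-\overline R\mathcal L(Q)\\&-2Q\mathcal L(\overline R)-\overline Q\mathcal L(B)-2B\mathcal L(\overline Q)-A\overline Q-\overline PQ-Q^2\overline R-BQ\overline Q\\&+2\overline{\mathcal L}(A)+\overline B\,\overline{\mathcal L}(B)+2B\overline{\mathcal L}(\overline B)+3B\mathcal L(B)+3AB+B^2Q+2B^2\overline B+2\overline R\mathcal L(\overline B)\\&+\overline B^2\overline R+\overline B\mathcal L(\overline R)+\overline B\,\overline P+Q\overline{\mathcal L}(B).\end{aligned}$$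
   Context: $M^5\subset\mathbb C^4$ is a local real analytic CR-generic submanifold of codimension $3$, in coordinates $z=x+iy$, $w_j=u_j+iv_j$ ($j=1,2,3$), given near the origin as a graph $v_j=\varphi_j(x,y,u_1,u_2,u_3)$ with $\varphi_j(0)=0$, $d\varphi_j(0)=0$; $(x,y,u_1,u_2,u_3)$ are coordinates on $M$. $\overline{\mathcal L}$ is the unique local generator of $T^{0,1}M$ whose intrinsic expression is $\partial_{\overline z}$ plus a combination of $\partial_{u_1},\partial_{u_2},\partial_{u_3}$; $\mathcal L$ is its conjugate. Put $\mathcal T:=i[\mathcal L,\overline{\mathcal L}]$ (real), $\mathcal S:=[\mathcal L,\mathcal T]$, $\overline{\mathcal S}:=[\overline{\mathcal L},\mathcal T]$. Maximally minimal means that $\{\overline{\mathcal S},\mathcal S,\mathcal T,\overline{\mathcal L},\mathcal L\}$ is a frame for $\mathbb C\otimes_{\mathbb R}TM$. The fundamental functions $P,Q,R,B$ (complex-valued) and $A$ (real-valued) are defined by $$[\mathcal L,\mathcal S]=P\mathcal T+Q\mathcal S+R\overline{\mathcal S},\qquad [\overline{\mathcal L},\mathcal S]=[\mathcal L,\overline{\mathcal S}]=A\mathcal T+B\mathcal S+\overline B\,\overline{\mathcal S},\qquad[\overline{\mathcal L},\overline{\mathcal S}]=\overline P\mathcal T+\overline R\mathcal S+\overline Q\,\overline{\mathcal S}.$$ *)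

(* Defs.v *)
From HB Require Import structures.
From mathcomp Require Import all_boot all_order all_algebra.
From mathcomp Require Import complex.
From mathcomp Require Import all_classical all_reals.
From mathcomp Require Import topology normedtype sequences derive.

Set Implicit Arguments.
Unset Strict Implicit.
Unset Printing Implicit Defensive.

Import Order.TTheory GRing.Theory Num.Theory.
Import numFieldNormedType.Exports.

Local Open Scope classical_set_scope.
Local Open Scope ring_scope.
Local Open Scope complex_scope.

(* The submanifold M is the graph v_j = phi_j (x, y, u_1, u_2, u_3) over an open
   neighbourhood U of 0 in the space of the coordinates (x, y, u_1, u_2, u_3);
   all functions and vector fields on M are expressed in these coordinates.
   They are total, but only their restrictions to U are meaningful. *)

Notation pt R := 'rV[R]_5.

Definition ix : 'I_5 := @Ordinal 5 0 isT.
Definition iy : 'I_5 := @Ordinal 5 1 isT.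
Definition iu (j : 'I_3) : 'I_5 := @rshift 2 3 j.

Definition pder (R : realType) (k : 'I_5) (f : pt R -> R) : pt R -> R :=
  fun p => 'D_(delta_mx 0 k) f p.

Definition iter_pder (R : realType) (s : seq 'I_5) (f : pt R -> R) :
  pt R -> R := foldr (@pder R) f s.

Definition smooth_on (R : realType) (U : set (pt R)) (f : pt R -> R) :=
  forall (s : seq 'I_5) p, U p -> differentiable (iter_pder s f) p.

Definition multi_pder (R : realType) (a : 'I_5 -> nat) (f : pt R -> R) :
  pt R -> R := iter_pder (flatten [seq nseq (a k) k | k <- enum 'I_5]) f.

Definition taylor_term (R : realType) (f : pt R -> R) (p h : pt R)
    (a : 'I_5 -> nat) : R :=
  multi_pder a f p / (\prod_k (a k)`!)%N%:R * \prod_k h 0 k ^+ a k.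

(* Smooth, and near every point of U the sum of its absolutely convergent
   Taylor series; the multi-indices are exhausted by the boxes [0, N)^5. *)
Definition real_analytic_on (R : realType) (U : set (pt R)) (f : pt R -> R) :=
  smooth_on U f /\
  forall p, U p -> exists2 r : R, 0 < r & forall h : pt R, `|h| < r ->
    (exists c : R, forall N : nat,
       \sum_(a : {ffun 'I_5 -> 'I_N}) `|taylor_term f p h (fun k => a k)| <= c)
    /\ (fun N : nat =>
          \sum_(a : {ffun 'I_5 -> 'I_N}) taylor_term f p h (fun k => a k))
         @ \oo --> f (p + h).

(* Complex-valued functions on M, and sections of C (x) TM; a section is given
   by its coefficients on d/dx, d/dy, d/du_1, d/du_2, d/du_3. *)

Notation cfun R := ('rV[R]_5 -> R[i]).
Notation cvfield R := ('rV[R]_5 -> 'rV[R[i]]_5).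

Definition conjf (R : realType) (f : cfun R) : cfun R := fun p => conjc (f p).

Definition conjv (R : realType) (X : cvfield R) : cvfield R :=
  fun p => map_mx (@conjc R) (X p).

Definition realf (R : realType) (f : pt R -> R) : cfun R := fun p => (f p)%:C.

Definition cpder (R : realType) (k : 'I_5) (f : cfun R) : cfun R :=
  fun p => pder k (fun q => complex.Re (f q)) p +i*
           pder k (fun q => complex.Im (f q)) p.

Definition vact (R : realType) (X : cvfield R) (f : cfun R) : cfun R :=
  fun p => \sum_k X p 0 k * cpder k f p.

Definition vbracket (R : realType) (X Y : cvfield R) : cvfield R :=
  fun p => \row_k (vact X (fun q => Y q 0 k) p - vact Y (fun q => X q 0 k) p).

(* The parametrization of M in C^4 with coordinates (z, w_1, w_2, w_3): real and
   imaginary parts of the ambient coordinates, and their differentials. *)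

Definition re_coord (R : realType) (k : 'I_4) (p : pt R) : R :=
  if unlift ord0 k is Some j then p 0 (iu j) else p 0 ix.

Definition im_coord (R : realType) (phi : 'I_3 -> pt R -> R) (k : 'I_4)
    (p : pt R) : R :=
  if unlift ord0 k is Some j then phi j p else p 0 iy.

Definition d_re (R : realType) (p : pt R) : 'M[R]_(5, 4) :=
  \matrix_(l, k) pder l (@re_coord R k) p.

Definition d_im (R : realType) (phi : 'I_3 -> pt R -> R) (p : pt R) :
  'M[R]_(5, 4) := \matrix_(l, k) pder l (im_coord phi k) p.

(* T_pM + J (T_pM) = T_pC^4, where J (a, b) = (- b, a) on pairs of real and
   imaginary parts. *)
Definition CR_generic_at (R : realType) (phi : 'I_3 -> pt R -> R) (p : pt R) :=
  forall a b : 'rV[R]_4, exists X Y : 'rV[R]_5,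
    a = X *m d_re p - Y *m d_im phi p /\ b = X *m d_im phi p + Y *m d_re p.

(* The image of X in C (x) T_pC^4 is a combination, with coefficients c_k, of the
   antiholomorphic vectors d/dzbar_k = (1/2) (d/dRe_k + i d/dIm_k). *)
Definition T01 (R : realType) (phi : 'I_3 -> pt R -> R) (p : pt R)
    (X : 'rV[R[i]]_5) :=
  exists c : 'rV[R[i]]_4,
    X *m map_mx (real_complex R) (d_re p) = 2^-1 *: c /\
    X *m map_mx (real_complex R) (d_im phi p) = ('i%C / 2) *: c.

(* Lb is a section of T^{0,1}M of the form d/dzbar + sum_j a_j d/du_j, with
   d/dzbar = (1/2) (d/dx + i d/dy). *)
Definition normalized_T01_section (R : realType) (U : set (pt R))
    (phi : 'I_3 -> pt R -> R) (Lb : cvfield R) :=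
  forall p, U p ->
    [/\ T01 phi p (Lb p), Lb p 0 ix = 2^-1 & Lb p 0 iy = 'i%C / 2].

Definition vT (R : realType) (Lb : cvfield R) : cvfield R :=
  fun p => 'i%C *: vbracket (conjv Lb) Lb p.

Definition vS (R : realType) (Lb : cvfield R) : cvfield R :=
  vbracket (conjv Lb) (vT Lb).

Definition vSb (R : realType) (Lb : cvfield R) : cvfield R :=
  vbracket Lb (vT Lb).

Definition maximally_minimal (R : realType) (U : set (pt R)) (Lb : cvfield R) :=
  forall p, U p ->
    basis_of {: 'rV[R[i]]_5}
      [:: vSb Lb p; vS Lb p; vT Lb p; Lb p; conjv Lb p].

(* Rf is the coefficient usually denoted R, R being here the field of real numbers. *)
Definition fundamental_functions (R : realType) (U : set (pt R))
    (Lb : cvfield R) (P Q Rf : cfun R) (A : pt R -> R) (B : cfun R) :=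
  let L := conjv Lb in
  let T := vT Lb in let S := vS Lb in let Sb := vSb Lb in
  forall p, U p ->
  [/\ vbracket L S p = P p *: T p + Q p *: S p + Rf p *: Sb p,
      vbracket Lb S p = realf A p *: T p + B p *: S p + conjf B p *: Sb p,
      vbracket L Sb p = realf A p *: T p + B p *: S p + conjf B p *: Sb p &
      vbracket Lb Sb p =
        conjf P p *: T p + conjf Rf p *: S p + conjf Q p *: Sb p].

(* Main.v *)
Require Import Defs.
From HB Require Import structures.
From mathcomp Require Import all_boot all_order all_algebra.
From mathcomp Require Import complex.
From mathcomp Require Import all_classical all_reals.
From mathcomp Require Import topology normedtype sequences derive.
From mathcomp Require Import landau ring lra.

Set Implicit Arguments.
Unset Strict Implicit.
Unset Printing Implicit Defensive.

Import Order.TTheory GRing.Theory Num.Theory.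
Import numFieldNormedType.Exports.

Local Open Scope classical_set_scope.
Local Open Scope ring_scope.
Local Open Scope complex_scope.

(* The bracket formulas are forced by the Jacobi identity. Since T = i [L, Lb],
   [T, X] = i ([L, [Lb, X]] - [Lb, [L, X]]), which for X = S, Sb only involves
   the brackets defining P, Q, R, A, B. Since S = [L, T],
   [S, Sb] = [L, [T, Sb]] - [T, [L, Sb]], and [T, f] = i (L Lb f - Lb L f) on
   functions. Writing [S, Sb] = - i (a T + b S + c Sb), conjugation exchanges S
   and Sb and changes the sign of [S, Sb], so a is real and c = conj b; the
   symmetric expressions for J and K are a + conj a and b + conj c.

   Analytically, only smoothness matters: Lb and the fundamental functions are
   smooth by Cramer's rule, the linear system for Lb being invertible by
   CR-genericity, and the partial derivatives of smooth functions commute. *)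

(** * Smooth real functions *)

(** The factor 2 in [-2J] and [2iK] comes from averaging. With X = [L, Sb] = [Lb, S], which is real,
    the Jacobi identity gives [S, Sb] = [L, [T, Sb]] - [T, X], and its conjugate is [Sb, S] = [Lb,
    [T, S]] - [T, X]. Subtracting, 2 [S, Sb] = [L, [T, Sb]] - [Lb, [T, S]]: every term coming from
    [T, X] disappears. The relations a = conj a and c = conj b are not formal identities between the
    formulas; they are compatibility conditions on P, Q, R, A, B, obtained by comparing coefficients
    in a free frame. The obstacle is regularity: [Lb] and the fundamental functions are given by
    pointwise conditions on [U]. An equality valued on [U] alone may be differentiated because [U]
    is open, hence a congruence lemma for each operator. *)

Lemma near_eq_differentiable (R : realType) (f g : pt R -> R) (p : pt R) :
  (\near p, f p = g p) -> differentiable f p -> differentiable g p.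
Proof.
move=> fg dfp; have [dfc dfE] := (diff_locallyP p f).1 dfp.
have fgp : f p = g p := nbhs_singleton fg.
have gE : g \o shift p = cst (g p) + 'd f p +o_ (0 : pt R) id.
  apply/eqaddoP => e e0; have /eqaddoP/(_ e e0) := dfE.
  have : \forall h \near (0 : pt R), f (h + p) = g (h + p).
    move: fg; rewrite (near_shift 0 p) /=.
    by apply: filterS => h /=; rewrite subr0.
  by apply: filterS2 => h /= fgh; rewrite !fctE /= fgp fgh.
(* The criterion is stated with the differential of [g] itself; uniqueness of the linear part in
   [gE] identifies it with that of [f]. *)
by apply/diff_locallyP; rewrite (diff_unique dfc gE).
Qed.

Lemma eq_on_open_near (R : realType) (V : Type) (U : set (pt R))
    (f g : pt R -> V) (p : pt R) :
  open U -> (forall q, U q -> f q = g q) -> U p -> \near p, f p = g p.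
Proof.
by move=> oU fg Up; move: (open_nbhs_nbhs (conj oU Up)); apply: filterS.
Qed.

Lemma pder_congr (R : realType) (U : set (pt R)) k (f g : pt R -> R) :
  open U -> (forall q, U q -> f q = g q) ->
  forall p, U p -> pder k f p = pder k g p.
Proof.
move=> oU fg p Up; rewrite /pder; apply: near_eq_derive.
exact: eq_on_open_near oU fg Up.
Qed.

(* Closure properties of smooth functions thus follow from first-order rules
   showing that some class C is stable under partial derivatives on U. *)
Lemma smooth_on_coind (R : realType) (U : set (pt R))
    (C : (pt R -> R) -> Prop) (oU : open U) :
  (forall f, C f -> forall p, U p -> differentiable f p) ->
  (forall f k, C f -> exists2 g, C g & forall p, U p -> pder k f p = g p) ->
  forall f, C f -> smooth_on U f.
Proof.
move=> Cd Cp f Cf s.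
suff [g Cg fg] : exists2 g, C g & forall p, U p -> iter_pder s f p = g p.
  move=> p Up; apply: near_eq_differentiable (Cd _ Cg _ Up).
  by apply: eq_on_open_near oU _ Up => q /fg.
elim: s => [|k s [g Cg sg]]; first by exists f.
have [h Ch gh] := Cp _ k Cg.
by exists h => // p Up; rewrite -gh //; apply: (pder_congr _ oU sg).
Qed.

Lemma smooth_on_pder (R : realType) (U : set (pt R)) k (f : pt R -> R) :
  smooth_on U f -> smooth_on U (pder k f).
Proof.
(* [foldr] applies the last index of the list first, so a derivative taken before those of [s] is
   appended at the end. *)
move=> sf s p Up; have := sf (rcons s k) p Up.
by rewrite /iter_pder -cats1 foldr_cat.
Qed.

Lemma smooth_on_diff (R : realType) (U : set (pt R)) (f : pt R -> R) p :
  smooth_on U f -> U p -> differentiable f p.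
Proof. by move=> sf; exact: (sf [::]). Qed.

Lemma pderD (R : realType) k (f g : pt R -> R) p :
  differentiable f p -> differentiable g p ->
  pder k (fun q => f q + g q) p = pder k f p + pder k g p.
Proof. by move=> df dg; apply: deriveD; exact: diff_derivable. Qed.

Lemma pderN (R : realType) k (f : pt R -> R) p :
  differentiable f p -> pder k (fun q => - f q) p = - pder k f p.
Proof. by move=> df; apply: deriveN; exact: diff_derivable. Qed.

Lemma pderM (R : realType) k (f g : pt R -> R) p :
  differentiable f p -> differentiable g p ->
  pder k (fun q => f q * g q) p = f p * pder k g p + g p * pder k f p.
Proof. by move=> df dg; apply: deriveM; exact: diff_derivable. Qed.

Lemma pderV (R : realType) k (f : pt R -> R) p :
  differentiable f p -> f p != 0 ->
  pder k (fun q => (f q)^-1) p = - (f p)^-1 * (f p)^-1 * pder k f p.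
Proof.
move=> df f0; rewrite /pder deriveV //; last exact: diff_derivable.
by rewrite /= mulNr -expr2 exprVn.
Qed.

Lemma pder_cst (R : realType) k (c : R) p : pder k (fun=> c) p = 0.
Proof. exact: derive_cst. Qed.

(** The class to which the coinduction principle is applied: formal expressions in smooth functions,
    stable under partial derivatives by the Leibniz and quotient rules. Stability holds up to
    equality on [U], since denominators are nonzero only there. *)
Inductive smooth_alg (R : realType) (U : set (pt R)) : (pt R -> R) -> Prop :=
| SmoothBase f of smooth_on U f : smooth_alg U f
| SmoothCst c : smooth_alg U (fun=> c)
| SmoothD f g of smooth_alg U f & smooth_alg U g :
    smooth_alg U (fun p => f p + g p)
| SmoothM f g of smooth_alg U f & smooth_alg U g :
    smooth_alg U (fun p => f p * g p)
| SmoothV f of smooth_alg U f & (forall p, U p -> f p != 0) :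
    smooth_alg U (fun p => (f p)^-1).

Lemma smooth_alg_diff (R : realType) (U : set (pt R)) (f : pt R -> R) :
  smooth_alg U f -> forall p, U p -> differentiable f p.
Proof.
elim=> {f} [f sf p|c p _|f g _ IHf _ IHg p Up|f g _ IHf _ IHg p Up
  |f _ IHf f0 p Up].
- exact: smooth_on_diff.
- exact: differentiable_cst.
- by apply: differentiableD; [exact: IHf|exact: IHg].
- by apply: differentiableM; [exact: IHf|exact: IHg].
- by apply: differentiableV; [exact: IHf|exact: f0].
Qed.

Lemma smooth_alg_pder (R : realType) (U : set (pt R)) (f : pt R -> R) k :
  smooth_alg U f ->
  exists2 g, smooth_alg U g & forall p, U p -> pder k f p = g p.
Proof.
elim=> {f} [f sf|c|f g sf [f' sf' ff'] sg [g' sg' gg']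
  |f g sf [f' sf' ff'] sg [g' sg' gg']|f sf [f' sf' ff'] f0].
- by exists (pder k f) => //; apply/SmoothBase/smooth_on_pder.
- exists (fun=> 0) => [|p _]; first exact: SmoothCst.
  exact: pder_cst.
- exists (fun p => f' p + g' p) => [|p Up]; first exact: SmoothD.
  rewrite pderD ?ff' ?gg' //; exact: smooth_alg_diff Up.
- exists (fun p => f p * g' p + g p * f' p) => [|p Up].
    by apply: SmoothD; apply: SmoothM.
  rewrite pderM ?ff' ?gg' //; exact: smooth_alg_diff Up.
- exists (fun p => (-1) * (f p)^-1 * (f p)^-1 * f' p) => [|p Up].
    have sV : smooth_alg U (fun p => (f p)^-1) by exact: SmoothV.
    do 3?apply: SmoothM => //; exact: SmoothCst.
  rewrite pderV ?ff' ?mulN1r ?f0 //; exact: smooth_alg_diff Up.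
Qed.

Lemma smooth_alg_smooth (R : realType) (U : set (pt R)) (f : pt R -> R) :
  open U -> smooth_alg U f -> smooth_on U f.
Proof.
move=> oU; apply: (smooth_on_coind oU) => [g|g k]; first exact: smooth_alg_diff.
exact: smooth_alg_pder.
Qed.

Lemma smooth_on_congr (R : realType) (U : set (pt R)) (f g : pt R -> R) :
  open U -> (forall p, U p -> f p = g p) -> smooth_on U f -> smooth_on U g.
Proof.
move=> oU fg sf s p Up.
have E q : U q -> iter_pder s f q = iter_pder s g q.
  elim: s q => [|k s IHs] q Uq /=; first exact: fg.
  exact: (pder_congr _ oU IHs).
exact/(near_eq_differentiable _ (sf s p Up))/(eq_on_open_near oU E).
Qed.

(** * Symmetry of second derivatives *)

(** The difference quotients of the two sides are the same function of the increment, so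
    derivability along [v] carries over to the line. *)
Lemma is_derive_line (R : realType) (V : normedModType R) (f : V -> R)
    (q v : V) (s : R) :
  derivable f (q + s *: v) v ->
  is_derive s 1 (fun t : R => f (q + t *: v)) ('D_v f (q + s *: v)).
Proof.
have E : (fun h : R => h^-1 *: (f (q + (h *: 1 + s) *: v) - f (q + s *: v)))
       = (fun h : R => h^-1 *: (f (h *: v + (q + s *: v)) - f (q + s *: v))).
  apply/funext => h; congr (_ *: (f _ - _)).
  by rewrite (_ : h *: 1 = h) ?scalerDl 1?addrCA //; exact: mulr1.
by move=> df; split; rewrite /derivable /derive /= E.
Qed.

(** The mean value theorem is applied twice: in the direction [v] to the increment [g] of [f] across
    the side [h *: w], then in the direction [w] to the derivative of [f] along [v]. *)
Lemma second_difference (R : realType) (V : normedModType R) (U : set V)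
    (f : V -> R) (p v w : V) (h : R) : 0 < h ->
  (forall s t, 0 <= s <= h -> 0 <= t <= h -> U (p + s *: v + t *: w)) ->
  (forall q, U q -> derivable f q v) ->
  (forall q, U q -> derivable ('D_v f) q w) ->
  exists s t, [/\ 0 <= s <= h, 0 <= t <= h &
    f (p + h *: v + h *: w) - f (p + h *: v) - f (p + h *: w) + f p
      = 'D_w ('D_v f) (p + s *: v + t *: w) * h * h].
Proof.
move=> h0 Urect dv dwv.
have h0' : 0 <= h <= h by rewrite lexx ltW.
have z0 : 0 <= (0 : R) <= h by rewrite lexx ltW.
pose g s := f (p + h *: w + s *: v) - f (p + s *: v).
pose g' s := 'D_v f (p + h *: w + s *: v) - 'D_v f (p + s *: v).
have dg s : 0 <= s <= h -> is_derive s 1 g (g' s).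
  move=> sh; apply: is_deriveB; apply: is_derive_line; apply: dv.
    by rewrite addrAC; exact: Urect.
  by have := Urect s 0 sh z0; rewrite scale0r addr0.
have [s sh Es] : exists2 s, s \in `]0, h[ & g h - g 0 = g' s * (h - 0).
  apply: MVT => // [s /itvP sh|]; first by apply: dg; rewrite !sh.
  apply: derivable_within_continuous => s /itvP sh.
  by apply: ex_derive; apply: dg; rewrite !sh.
have sh' : 0 <= s <= h by rewrite !(itvP sh).
pose k t := 'D_v f (p + s *: v + t *: w).
have dk t : 0 <= t <= h ->
    is_derive t 1 k ('D_w ('D_v f) (p + s *: v + t *: w)).
  by move=> th; apply: is_derive_line; apply: dwv; exact: Urect.
have [t th Et] : exists2 t, t \in `]0, h[ &
    k h - k 0 = 'D_w ('D_v f) (p + s *: v + t *: w) * (h - 0).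
  apply: MVT => // [t /itvP th|]; first by apply: dk; rewrite !th.
  apply: derivable_within_continuous => t /itvP th.
  by apply: ex_derive; apply: dk; rewrite !th.
exists s, t; split => //; first by rewrite !(itvP th).
have gk : g' s = k h - k 0.
  by rewrite /g' /k scale0r addr0 [p + h *: w + _]addrAC.
move: Es; rewrite gk Et !subr0 => <-.
by rewrite /g !scale0r !addr0 [p + h *: w + _]addrAC; ring.
Qed.

(** The second difference over a parallelogram is symmetric in [v] and [w], so both mixed
    derivatives take a common value at points, possibly distinct, as close to [p] as desired. If
    they differed at [p], continuity would keep their values apart nearby. *)
Lemma derive_comm (R : realType) (V : normedModType R) (U : set V)
    (f : V -> R) (p v w : V) : open U -> U p ->
  (forall q, U q -> derivable f q v) ->
  (forall q, U q -> derivable f q w) ->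
  (forall q, U q -> derivable ('D_v f) q w) ->
  (forall q, U q -> derivable ('D_w f) q v) ->
  {for p, continuous ('D_w ('D_v f))} -> {for p, continuous ('D_v ('D_w f))} ->
  'D_w ('D_v f) p = 'D_v ('D_w f) p.
Proof.
move=> oU Up dv dw dwv dvw cwv cvw; apply/eqP; rewrite -subr_eq0 -normr_eq0.
set a := 'D_w ('D_v f) p; set b := 'D_v ('D_w f) p.
rewrite eq_le normr_ge0 andbT leNgt; apply/negP => ab0.
have e0 : 0 < `|a - b| / 2 by rewrite divr_gt0.
have na : \forall q \near p, `|a - 'D_w ('D_v f) q| < `|a - b| / 2.
  by move/cvgr_dist_lt: cwv; apply.
have nb : \forall q \near p, `|b - 'D_v ('D_w f) q| < `|a - b| / 2.
  by move/cvgr_dist_lt: cvw; apply.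
have nU : \near p, U p by exact: open_nbhs_nbhs.
have [r /= r0 rP] : exists2 r : R, 0 < r & forall q, ball p r q ->
    [/\ U q, `|a - 'D_w ('D_v f) q| < `|a - b| / 2
       & `|b - 'D_v ('D_w f) q| < `|a - b| / 2].
  have nP : \forall q \near p, [/\ U q,
      `|a - 'D_w ('D_v f) q| < `|a - b| / 2
    & `|b - 'D_v ('D_w f) q| < `|a - b| / 2].
    by move: nU na nb; apply: filterS3 => q Uq aq bq; split.
  by have /nbhs_ballP[r /= r0 rP] := nP; exists r.
(* The side [h = r / M] keeps the parallelogram inside the ball of radius [r]; the added 1 makes [M]
   positive and the inclusion strict. *)
pose M := `|v| + `|w| + 1; have M0 : 0 < M by rewrite ltr_wpDl ?addr_ge0.
pose h := r / M; have h0 : 0 < h by rewrite divr_gt0.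
have hr s t : 0 <= s <= h -> 0 <= t <= h -> ball p r (p + s *: v + t *: w).
  move=> /andP[s0 sh] /andP[t0 th]; rewrite -ball_normE /= -addrA opprD addNKr.
  rewrite normrN (le_lt_trans (ler_normD _ _)) // !normrZ !ger0_norm //.
  have -> : r = h * M by rewrite divfK // gt_eqF.
  rewrite /M mulrDr mulr1 mulrDr ltr_pwDr // lerD // ler_wpM2r //.
have [s [t [sh th E1]]] := second_difference h0
  (fun s t sh th => let: And3 Uq _ _ := rP _ (hr s t sh th) in Uq) dv dwv.
have hr' s' t' : 0 <= s' <= h -> 0 <= t' <= h ->
  ball p r (p + s' *: w + t' *: v) by move=> *; rewrite addrAC; exact: hr.
have [s' [t' [sh' th' E2]]] := second_difference h0
  (fun s t sh th => let: And3 Uq _ _ := rP _ (hr' s t sh th) in Uq) dw dvw.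
have [_ ha _] := rP _ (hr _ _ sh th).
have [_ _ hb] := rP _ (hr' _ _ sh' th').
have {E1 E2} : 'D_w ('D_v f) (p + s *: v + t *: w) * h * h
    = 'D_v ('D_w f) (p + s' *: w + t' *: v) * h * h.
  by rewrite -E1 -E2 [p + h *: w + _]addrAC; ring.
move: ha hb; set c := 'D_w _ _; set c' := 'D_v _ _.
move: a b c c' {na nb rP cwv cvw e0} ab0 => a b c c' ab0 ha hb.
have h00 : h != 0 by rewrite gt_eqF.
move=> /(mulIf h00)/(mulIf h00) cc'; rewrite -{}cc' in hb.
have : `|a - b| < `|a - b| / 2 + `|a - b| / 2.
  rewrite {1}(_ : a - b = (a - c) - (b - c)); last by ring.
  by rewrite (le_lt_trans (ler_normB _ _)) // ltrD.
by rewrite -splitr ltxx.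
Qed.

Lemma pderC (R : realType) (U : set (pt R)) k l (f : pt R -> R) p :
  open U -> smooth_on U f -> U p ->
  pder k (pder l f) p = pder l (pder k f) p.
Proof.
move=> oU sf Up.
have d s q j : U q -> derivable (iter_pder s f) q (delta_mx 0 j).
  by move=> Uq; apply: diff_derivable; exact: sf.
have c s : {for p, continuous (iter_pder s f)}.
  exact/differentiable_continuous/sf.
apply: (derive_comm oU Up (d [::] ^~ l) (d [::] ^~ k) (d [:: l] ^~ k)
  (d [:: k] ^~ l)); [exact: (c [:: k; l])|exact: (c [:: l; k])].
Qed.

(** * Smooth complex functions *)

Definition csmooth (R : realType) (U : set (pt R)) (f : cfun R) :=
  smooth_on U (fun p => complex.Re (f p)) /\
  smooth_on U (fun p => complex.Im (f p)).

Definition vsmooth (R : realType) (U : set (pt R)) (X : cvfield R) :=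
  forall k, csmooth U (fun p => X p 0 k).

Section SmoothFunctions.
Context (R : realType) (U : set (pt R)) (oU : open U).
Implicit Types (f g : cfun R) (X Y Z : cvfield R) (p : pt R).

Lemma csmooth_alg f : smooth_alg U (fun p => complex.Re (f p)) ->
  smooth_alg U (fun p => complex.Im (f p)) -> csmooth U f.
Proof. by split; exact: smooth_alg_smooth. Qed.

Lemma csmooth_congr f g :
  (forall p, U p -> f p = g p) -> csmooth U f -> csmooth U g.
Proof.
move=> fg [sr si].
by split; [apply: smooth_on_congr sr|apply: smooth_on_congr si] => // p /fg->.
Qed.

Lemma csmooth_realf (h : pt R -> R) : smooth_on U h -> csmooth U (realf h).
Proof.
by move=> sh; apply: csmooth_alg; [exact: SmoothBase|exact: SmoothCst].
Qed.

Lemma csmooth_cst (c : R[i]) : csmooth U (fun=> c).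
Proof. by apply: csmooth_alg; exact: SmoothCst. Qed.

Lemma csmoothD f g : csmooth U f -> csmooth U g -> csmooth U (f + g).
Proof.
move=> [sfr sfi] [sgr sgi]; apply: csmooth_alg.
  rewrite (_ : (fun p => _) =
    (fun p => complex.Re (f p) + complex.Re (g p))).
    by apply: SmoothD; exact: SmoothBase.
  by apply/funext => p; rewrite fctE; case: (f p) (g p) => [? ?] [].
rewrite (_ : (fun p => _) = (fun p => complex.Im (f p) + complex.Im (g p))).
  by apply: SmoothD; exact: SmoothBase.
by apply/funext => p; rewrite fctE; case: (f p) (g p) => [? ?] [].
Qed.

Lemma csmoothM f g : csmooth U f -> csmooth U g -> csmooth U (f * g).
Proof.
move=> [sfr sfi] [sgr sgi]; apply: csmooth_alg.
  rewrite (_ : (fun p => _) = (fun p => complex.Re (f p) * complex.Re (g p) +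
    -1 * (complex.Im (f p) * complex.Im (g p)))).
    apply: SmoothD; last (apply: SmoothM; first exact: SmoothCst);
      by apply: SmoothM; exact: SmoothBase.
  by apply/funext => p; rewrite fctE mulN1r; case: (f p) (g p) => [? ?] [].
rewrite (_ : (fun p => _) = (fun p => complex.Re (f p) * complex.Im (g p) +
  complex.Im (f p) * complex.Re (g p))).
  by apply: SmoothD; apply: SmoothM; exact: SmoothBase.
by apply/funext => p; rewrite fctE; case: (f p) (g p) => [? ?] [].
Qed.

Lemma csmooth_conj f : csmooth U f -> csmooth U (conjf f).
Proof.
move=> [sfr sfi]; apply: csmooth_alg.
  rewrite (_ : (fun p => _) = (fun p => complex.Re (f p))).
    exact: SmoothBase.
  by apply/funext => p; rewrite /conjf; case: (f p).
rewrite (_ : (fun p => _) = (fun p => -1 * complex.Im (f p))).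
  by apply: SmoothM; [exact: SmoothCst|exact: SmoothBase].
by apply/funext => p; rewrite /conjf mulN1r; case: (f p).
Qed.

Lemma csmoothN f : csmooth U f -> csmooth U (- f).
Proof.
move=> sf; have := csmoothM (csmooth_cst (-1)) sf.
by apply: csmooth_congr => p _; rewrite fctE mulN1r.
Qed.

(** Writing 1 / f as conj f / |f|^2 reduces the claim to inverting the nonvanishing real function
    [N]. *)
Lemma csmoothV f : csmooth U f -> (forall p, U p -> f p != 0) ->
  csmooth U (fun p => (f p)^-1).
Proof.
move=> sf f0; have [sNr _] := csmoothM sf (csmooth_conj sf).
pose N p := complex.Re (f p * conjc (f p)).
have N0 p : U p -> N p != 0.
  move=> /f0; rewrite /N; case: (f p) => a b; rewrite eq_complex /= => ab0.
  by rewrite mulrN opprK -!expr2 paddr_eq0 ?sqr_ge0 // !sqrf_eq0.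
have sNV : csmooth U (realf (fun p => (N p)^-1)).
  apply/csmooth_realf/(smooth_alg_smooth oU)/SmoothV => //.
  exact: SmoothBase.
apply: csmooth_congr (csmoothM (csmooth_conj sf) sNV) => p Up.
have fp0 := f0 p Up; have Np0 := N0 p Up.
apply: (mulfI fp0); rewrite divff // fctE mulrA /realf /conjf.
have -> : f p * conjc (f p) = (N p)%:C.
  rewrite /N; case: (f p) => a b; apply/eqP; rewrite eq_complex /= eqxx /=.
  by apply/eqP; ring.
by rewrite -rmorphM /= divff.
Qed.

Lemma csmooth_cpder k f : csmooth U f -> csmooth U (cpder k f).
Proof. by move=> [sfr sfi]; split; exact: smooth_on_pder. Qed.

Lemma csmooth_sum (I : Type) (r : seq I) (P : pred I) (F : I -> cfun R) :
  (forall i, csmooth U (F i)) -> csmooth U (fun p => \sum_(i <- r | P i) F i p).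
Proof.
move=> sF; elim: r => [|i r IHr].
  by apply: csmooth_congr (csmooth_cst 0) => p _; rewrite big_nil.
case Pi : (P i); last by apply: csmooth_congr IHr => p _; rewrite big_cons Pi.
by apply: csmooth_congr (csmoothD (sF i) IHr) => p _; rewrite big_cons Pi.
Qed.

Lemma csmooth_prod (I : Type) (r : seq I) (P : pred I) (F : I -> cfun R) :
  (forall i, csmooth U (F i)) ->
  csmooth U (fun p => \prod_(i <- r | P i) F i p).
Proof.
move=> sF; elim: r => [|i r IHr].
  by apply: csmooth_congr (csmooth_cst 1) => p _; rewrite big_nil.
case Pi : (P i); last by apply: csmooth_congr IHr => p _; rewrite big_cons Pi.
by apply: csmooth_congr (csmoothM (sF i) IHr) => p _; rewrite big_cons Pi.
Qed.

Lemma csmooth_det n (M : pt R -> 'M[R[i]]_n) :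
  (forall i j, csmooth U (fun p => M p i j)) -> csmooth U (fun p => \det (M p)).
Proof.
move=> sM; apply: csmooth_sum => s.
exact: csmoothM (csmooth_cst _) (csmooth_prod _ _ _).
Qed.

(** A solution of an invertible linear system with smooth data is smooth: on [U] its entries are
    polynomials in the data divided by the determinant. This is how regularity reaches [Lb] and the
    fundamental functions. *)
Lemma csmooth_cramer n (M : pt R -> 'M[R[i]]_n) (c v : pt R -> 'rV[R[i]]_n) :
  (forall i j, csmooth U (fun p => M p i j)) ->
  (forall j, csmooth U (fun p => v p 0 j)) ->
  (forall p, U p -> M p \in unitmx) ->
  (forall p, U p -> c p *m M p = v p) ->
  forall j, csmooth U (fun p => c p 0 j).
Proof.
move=> sM sv uM cM j.
have sV : csmooth U (fun p => (\det (M p))^-1).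
  by apply: csmoothV (csmooth_det sM) _ => p /uM; rewrite unitmxE unitfE.
have sW : csmooth U (fun p => \sum_i v p 0 i * (\adj (M p)) i j).
  apply: csmooth_sum => i; apply: csmoothM (sv i) _.
  rewrite (_ : (fun p => _) =
    (fun p => (-1) ^+ (j + i) * \det (row' j (col' i (M p))))).
    apply: csmoothM (csmooth_cst _) (csmooth_det _) => i' j'.
    by rewrite (_ : (fun p => _) = (fun p => M p (lift j i') (lift i j'))) //;
      apply/funext => p; rewrite !mxE.
  by apply/funext => p; rewrite !mxE.
apply: csmooth_congr (csmoothM sV sW) => p Up.
rewrite -[c p](mulmxK (uM p Up)) cM // /invmx uM //.
by rewrite -scalemxAr [RHS]mxE [in RHS]mxE fctE.
Qed.

Lemma cdiff f p : csmooth U f -> U p ->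
  differentiable (fun q => complex.Re (f q)) p /\
  differentiable (fun q => complex.Im (f q)) p.
Proof. by move=> [sr si] Up; split; apply: smooth_on_diff Up. Qed.

Lemma cpder_congr k f g : (forall q, U q -> f q = g q) ->
  forall p, U p -> cpder k f p = cpder k g p.
Proof.
move=> fg p Up; rewrite /cpder.
by congr (_ +i* _); apply: (pder_congr _ oU) => // q /fg ->.
Qed.

Lemma cpder_cst k (c : R[i]) p : cpder k (fun=> c) p = 0.
Proof. by rewrite /cpder !pder_cst. Qed.

Lemma cpderD k f g p : csmooth U f -> csmooth U g -> U p ->
  cpder k (f + g) p = cpder k f p + cpder k g p.
Proof.
move=> /cdiff df /cdiff dg Up.
have [[dfr dfi] [dgr dgi]] := (df p Up, dg p Up); rewrite /cpder.
rewrite (_ : (fun q => complex.Re _) =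
  (fun p => complex.Re (f p) + complex.Re (g p))); last first.
  by apply/funext => q; rewrite fctE; case: (f q) (g q) => [? ?] [].
rewrite (_ : (fun q => complex.Im _) =
  (fun p => complex.Im (f p) + complex.Im (g p))); last first.
  by apply/funext => q; rewrite fctE; case: (f q) (g q) => [? ?] [].
by rewrite !pderD.
Qed.

Lemma cpderM k f g p : csmooth U f -> csmooth U g -> U p ->
  cpder k (f * g) p = f p * cpder k g p + g p * cpder k f p.
Proof.
move=> /cdiff df /cdiff dg Up.
have [[dfr dfi] [dgr dgi]] := (df p Up, dg p Up); rewrite /cpder.
rewrite (_ : (fun q => complex.Re _) = (fun p => complex.Re (f p) *
  complex.Re (g p) + - (complex.Im (f p) * complex.Im (g p)))); last first.
  by apply/funext => q; rewrite fctE; case: (f q) (g q) => [? ?] [].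
rewrite (_ : (fun q => complex.Im _) = (fun p => complex.Re (f p) *
  complex.Im (g p) + complex.Im (f p) * complex.Re (g p))); last first.
  by apply/funext => q; rewrite fctE; case: (f q) (g q) => [? ?] [].
have dM (a b : pt R -> R) : differentiable a p -> differentiable b p ->
  differentiable (fun q => a q * b q) p by exact: differentiableM.
rewrite !pderD ?pderN ?pderM //; try exact: dM.
  case: (f p) (g p) => [a b] [c d] /=.
  by apply/eqP; rewrite eq_complex /=; apply/andP; split; apply/eqP; ring.
by apply: differentiableN; exact: dM.
Qed.

Lemma cpderN k f p : csmooth U f -> U p -> cpder k (- f) p = - cpder k f p.
Proof.
move=> sf Up; have := cpderM k (csmooth_cst (-1)) sf Up.
rewrite cpder_cst mulr0 addr0 => E; rewrite -[RHS]mulN1r -E.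
by apply: cpder_congr Up => q _; rewrite !fctE mulN1r.
Qed.

Lemma cpder_conj k f p : csmooth U f -> U p ->
  cpder k (conjf f) p = conjc (cpder k f p).
Proof.
move=> /cdiff df Up; have [dfr dfi] := df p Up; rewrite /cpder /=.
rewrite -pderN //; congr (_ +i* _); congr (pder k _ p);
  by apply/funext => q; rewrite /conjf; case: (f q).
Qed.

Lemma cpderC k l f p : csmooth U f -> U p ->
  cpder k (cpder l f) p = cpder l (cpder k f) p.
Proof. by move=> [sr si] Up; rewrite /cpder /= !(pderC k l oU) //. Qed.

Lemma cpder_sum (I : Type) (r : seq I) (F : I -> cfun R) k p :
  (forall i, csmooth U (F i)) -> U p ->
  cpder k (fun q => \sum_(i <- r) F i q) p = \sum_(i <- r) cpder k (F i) p.
Proof.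
move=> sF Up; elim: r => [|i r IHr].
  rewrite big_nil -[RHS](cpder_cst k 0 p).
  by apply: cpder_congr Up => q _; rewrite big_nil.
rewrite big_cons -IHr -cpderD //; last exact: csmooth_sum.
by apply: cpder_congr Up => q _; rewrite big_cons.
Qed.

End SmoothFunctions.

(** * Vector fields *)

Section VectorFields.
Context (R : realType) (U : set (pt R)) (oU : open U).
Implicit Types (f g : cfun R) (X Y Z : cvfield R) (p : pt R).

Lemma vact_congr X X' f f' :
  (forall p, U p -> X p = X' p) -> (forall p, U p -> f p = f' p) ->
  forall p, U p -> vact X f p = vact X' f' p.
Proof.
move=> XX' ff' p Up; apply: eq_bigr => k _.
by rewrite XX' // (cpder_congr oU k ff').
Qed.

Lemma vact_smooth X f : vsmooth U X -> csmooth U f -> csmooth U (vact X f).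
Proof.
move=> sX sf; apply: csmooth_sum => // k.
exact: csmoothM (sX k) (csmooth_cpder k sf).
Qed.

Lemma vact_cst X (c : R[i]) p : vact X (fun=> c) p = 0.
Proof. by rewrite /vact big1 // => k _; rewrite cpder_cst mulr0. Qed.

Lemma vactD X f g p : csmooth U f -> csmooth U g -> U p ->
  vact X (f + g) p = vact X f p + vact X g p.
Proof.
move=> sf sg Up; rewrite /vact -big_split /=; apply: eq_bigr => k _.
by rewrite (cpderD k sf sg Up) mulrDr.
Qed.

Lemma vactM X f g p : csmooth U f -> csmooth U g -> U p ->
  vact X (f * g) p = f p * vact X g p + g p * vact X f p.
Proof.
move=> sf sg Up; rewrite /vact !big_distrr -big_split /=; apply: eq_bigr => k _.
by rewrite (cpderM k sf sg Up); ring.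
Qed.

Lemma vactN X f p : csmooth U f -> U p -> vact X (- f) p = - vact X f p.
Proof.
move=> sf Up; rewrite /vact -sumrN; apply: eq_bigr => k _.
by rewrite (cpderN oU k sf Up) mulrN.
Qed.

Lemma vact_conj X f p : csmooth U f -> U p ->
  vact (conjv X) (conjf f) p = conjc (vact X f p).
Proof.
move=> sf Up; rewrite /vact rmorph_sum; apply: eq_bigr => k _.
by rewrite (cpder_conj k sf Up) mxE -rmorphM.
Qed.

Lemma vactZl (a : R[i]) X f p :
  vact (fun q => a *: X q) f p = a * vact X f p.
Proof.
by rewrite /vact mulr_sumr; apply: eq_bigr => k _; rewrite mxE mulrA.
Qed.

(** The second-order parts of X Y f and Y X f coincide by symmetry of the second partial
    derivatives; the first-order parts are the coefficients defining the bracket. *)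
Lemma vact_bracket X Y f p : vsmooth U X -> vsmooth U Y -> csmooth U f ->
  U p -> vact (vbracket X Y) f p = vact X (vact Y f) p - vact Y (vact X f) p.
Proof.
have half X' Y' : vsmooth U X' -> vsmooth U Y' -> csmooth U f -> U p ->
    vact X' (vact Y' f) p = \sum_m vact X' (fun q => Y' q 0 m) p * cpder m f p
      + \sum_k \sum_m X' p 0 k * (Y' p 0 m * cpder k (cpder m f) p).
  move=> sX sY sf Up; rewrite {1}/vact.
  have E k : cpder k (vact Y' f) p = \sum_m (cpder k (fun q => Y' q 0 m) p *
      cpder m f p + Y' p 0 m * cpder k (cpder m f) p).
    rewrite {1}/vact (cpder_sum oU) // => [|m].
      apply: eq_bigr => m _; rewrite addrC [X in _ + X]mulrC.
      exact: (cpderM k (sY m) (csmooth_cpder m sf) Up).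
    exact: (csmoothM oU (sY m) (csmooth_cpder m sf)).
  under eq_bigr => k _ do rewrite E big_split mulrDr !mulr_sumr.
  rewrite big_split /= exchange_big /=; congr (_ + _).
  by apply: eq_bigr => m _; rewrite mulr_suml; apply: eq_bigr => k _; ring.
move=> sX sY sf Up; rewrite !half // [X in _ - (_ + X)]exchange_big /=.
under [X in _ - (_ + X)]eq_bigr => k _ do
  under eq_bigr => m _ do rewrite (cpderC oU m k sf Up) mulrCA.
rewrite opprD addrACA subrr addr0 -sumrB {1}/vact.
by apply: eq_bigr => k _; rewrite mxE mulrBl.
Qed.

Lemma vsmoothZ f X : csmooth U f -> vsmooth U X ->
  vsmooth U (fun p => f p *: X p).
Proof.
move=> sf sX k; rewrite (_ : (fun p => _) = f * (fun p => X p 0 k)).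
  exact: csmoothM.
by apply/funext => p; rewrite mxE.
Qed.

Lemma vsmoothD X Y : vsmooth U X -> vsmooth U Y ->
  vsmooth U (fun p => X p + Y p).
Proof.
move=> sX sY k.
rewrite (_ : (fun p => _) = (fun p => X p 0 k) + (fun p => Y p 0 k)).
  exact: csmoothD.
by apply/funext => p; rewrite mxE.
Qed.

Lemma vsmooth_conj X : vsmooth U X -> vsmooth U (conjv X).
Proof.
move=> sX k; rewrite (_ : (fun p => _) = conjf (fun p => X p 0 k)).
  exact: csmooth_conj.
by apply/funext => p; rewrite mxE.
Qed.

Lemma vbracket_coord X Y k : (fun p => vbracket X Y p 0 k) =
  vact X (fun p => Y p 0 k) - vact Y (fun p => X p 0 k).
Proof. by apply/funext => p; rewrite mxE. Qed.

Lemma vsmooth_bracket X Y : vsmooth U X -> vsmooth U Y ->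
  vsmooth U (vbracket X Y).
Proof.
move=> sX sY k; rewrite vbracket_coord.
by apply: csmoothD => //; [|apply: csmoothN => //]; exact: vact_smooth.
Qed.

Lemma vbracketC X Y p : vbracket X Y p = - vbracket Y X p.
Proof. by apply/rowP => k; rewrite !mxE opprB. Qed.

Lemma vbracket_congr X X' Y Y' :
  (forall p, U p -> X p = X' p) -> (forall p, U p -> Y p = Y' p) ->
  forall p, U p -> vbracket X Y p = vbracket X' Y' p.
Proof.
move=> XX' YY' p Up; apply/rowP => k; rewrite !mxE.
by congr (_ - _); apply: vact_congr Up => // q Uq; rewrite (XX', YY').
Qed.

Lemma vbracketD X Y Z p : vsmooth U Y -> vsmooth U Z -> U p ->
  vbracket X (fun q => Y q + Z q) p = vbracket X Y p + vbracket X Z p.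
Proof.
move=> sY sZ Up; apply/rowP => k; rewrite !mxE addrACA -opprD; congr (_ - _).
  rewrite -(vactD X (sY k) (sZ k) Up).
  by apply: vact_congr Up => // q _; rewrite mxE.
by rewrite /vact -big_split; apply: eq_bigr => m _; rewrite mxE mulrDl.
Qed.

Lemma vbracketZ X f Y p : csmooth U f -> vsmooth U Y -> U p ->
  vbracket X (fun q => f q *: Y q) p
    = vact X f p *: Y p + f p *: vbracket X Y p.
Proof.
move=> sf sY Up; apply/rowP => k; rewrite !mxE.
have -> : vact X (fun q => (f q *: Y q) 0 k) p
    = vact X (f * (fun q => Y q 0 k)) p.
  by apply: vact_congr Up => // q _; rewrite mxE.
rewrite (vactM X sf (sY k) Up).
have -> : vact (fun q => f q *: Y q) (fun q => X q 0 k) p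
    = f p * vact Y (fun q => X q 0 k) p.
  by rewrite /vact mulr_sumr; apply: eq_bigr => m _; rewrite mxE mulrA.
by ring.
Qed.

Lemma vbracketZl (a : R[i]) X Y p : vsmooth U X -> U p ->
  vbracket (fun q => a *: X q) Y p = a *: vbracket X Y p.
Proof.
move=> sX Up; rewrite vbracketC (vbracketZ Y (csmooth_cst oU a) sX Up) vact_cst.
by rewrite scale0r add0r -scalerN -vbracketC.
Qed.

Lemma vbracket_comb3 X (f1 f2 f3 : cfun R) (Y1 Y2 Y3 : cvfield R) p :
  csmooth U f1 -> csmooth U f2 -> csmooth U f3 ->
  vsmooth U Y1 -> vsmooth U Y2 -> vsmooth U Y3 -> U p ->
  vbracket X (fun q => f1 q *: Y1 q + f2 q *: Y2 q + f3 q *: Y3 q) p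
    = (vact X f1 p *: Y1 p + f1 p *: vbracket X Y1 p)
    + (vact X f2 p *: Y2 p + f2 p *: vbracket X Y2 p)
    + (vact X f3 p *: Y3 p + f3 p *: vbracket X Y3 p).
Proof.
move=> sf1 sf2 sf3 sY1 sY2 sY3 Up.
by rewrite vbracketD ?vbracketD ?vbracketZ //; do ?apply: vsmoothD;
  exact: vsmoothZ.
Qed.

(** On each coordinate, both sides become sums of the six composites of two fields acting on a
    coefficient of the third, once brackets acting on functions are replaced by commutators. *)
Lemma vbracket_jacobi X Y Z p : vsmooth U X -> vsmooth U Y -> vsmooth U Z ->
  U p -> vbracket (vbracket X Y) Z p
    = vbracket X (vbracket Y Z) p - vbracket Y (vbracket X Z) p.
Proof.
move=> sX sY sZ Up; apply/rowP => k; rewrite !mxE.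
rewrite (vact_bracket sX sY (sZ k) Up) !vbracket_coord.
have sub (W V V' : cvfield R) :
    vsmooth U W -> vsmooth U V -> vsmooth U V' ->
    vact W (vact V (fun q => V' q 0 k) - vact V' (fun q => V q 0 k)) p
    = vact W (vact V (fun q => V' q 0 k)) p
      - vact W (vact V' (fun q => V q 0 k)) p.
  move=> sW sV sV'; rewrite vactD ?vactN //; try exact: vact_smooth.
  by apply: csmoothN => //; exact: vact_smooth.
rewrite !sub //.
rewrite (vact_bracket sX sZ (sY k) Up) (vact_bracket sY sZ (sX k) Up).
move: (vact X (vact Y _) p) (vact Y (vact X _) p) (vact X (vact Z _) p)
  (vact Z (vact X _) p) (vact Y (vact Z _) p) (vact Z (vact Y _) p).
by move=> a b c d e f; ring.
Qed.

Lemma vbracket_conj X Y p : vsmooth U X -> vsmooth U Y -> U p ->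
  vbracket (conjv X) (conjv Y) p = conjv (vbracket X Y) p.
Proof.
move=> sX sY Up; apply/rowP => k; rewrite !mxE rmorphB /=.
have E (V W : cvfield R) : vsmooth U V ->
    vact (conjv W) (fun q => conjv V q 0 k) p
      = conjc (vact W (fun q => V q 0 k) p).
  move=> sV; rewrite -(vact_conj _ (sV k)) //.
  by apply: vact_congr Up => // q _; rewrite mxE.
by rewrite !E.
Qed.

End VectorFields.

(** * Smoothness of the section and of frame coefficients *)

Section Frame.
Context (R : realType) (U : set (pt R)) (oU : open U).

Lemma sum_coords (V : nmodType) (F : 'I_5 -> V) :
  \sum_k F k = F ix + F iy + \sum_(j < 3) F (iu j).
Proof.
rewrite -[5%N]/(2 + 3)%N big_split_ord /= !big_ord_recl big_ord0 addr0.
by congr (F _ + F _ + _); apply: val_inj.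
Qed.

Lemma coord_cases (k : 'I_5) : [\/ k = ix, k = iy | exists j, k = iu j].
Proof.
case: (@split_ordP 2 3 k) => [[[|[|//]] ?] ->|j ->].
- by constructor 1; exact: val_inj.
- by constructor 2; exact: val_inj.
- by constructor 3; exists j.
Qed.

Lemma pder_coord k l (p : pt R) :
  pder k (fun q : pt R => q 0 l) p = (l == k)%:R.
Proof.
(* The coordinate function is packaged as a continuous linear map, which is its own differential. *)
have @f : {linear pt R -> R}.
  by exists (fun N : pt R => N 0 l); do 2![eexists]; do ?[constructor];
     rewrite ?mxE// => ? *; rewrite ?mxE//; move=> ?; rewrite !mxE.
rewrite /pder deriveE; last exact: differentiable_coord.
have cf : continuous f by exact: coord_continuous.
by rewrite -[fun q => _]/(f : pt R -> R) diff_lin //= mxE eqxx.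
Qed.

Lemma d_re0 l (p : pt R) : d_re p l ord0 = (ix == l)%:R.
Proof.
by rewrite mxE -(pder_coord l ix p) /re_coord unlift_none.
Qed.

Lemma d_reS l (p : pt R) j : d_re p l (lift ord0 j) = (iu j == l)%:R.
Proof. by rewrite mxE -(pder_coord l (iu j) p) /re_coord liftK. Qed.

Lemma d_im0 (phi : 'I_3 -> pt R -> R) l (p : pt R) :
  d_im phi p l ord0 = (iy == l)%:R.
Proof. by rewrite mxE -(pder_coord l iy p) /im_coord unlift_none. Qed.

Lemma d_imS (phi : 'I_3 -> pt R -> R) l (p : pt R) j :
  d_im phi p l (lift ord0 j) = pder l (phi j) p.
Proof. by rewrite mxE /im_coord liftK. Qed.

(** Since (X + iY)(D1 + i D2) = (X D1 - Y D2) + i (X D2 + Y D1), genericity solves the complex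
    system for every real right-hand side, in particular for the rows of the identity. For the graph
    this says that dz, dw_1, dw_2, dw_3 restrict to independent forms on M. *)
Lemma generic_row_full m n (D1 D2 : 'M[R]_(m, n)) :
  (forall a b : 'rV[R]_n, exists X Y : 'rV[R]_m,
     a = X *m D1 - Y *m D2 /\ b = X *m D2 + Y *m D1) ->
  row_full (map_mx (real_complex R) D1 + 'i%C *: map_mx (real_complex R) D2)%R.
Proof.
move=> gen; rewrite -sub1mx; apply/row_subP => k.
have [X [Y [EX EY]]] := gen (row k 1%:M) 0.
apply/submxP.
exists (map_mx (real_complex R) X + 'i%C *: map_mx (real_complex R) Y).
have -> : row k 1%:M = map_mx (real_complex R) (row k 1%:M)
    + 'i%C *: map_mx (real_complex R) (0 : 'rV_n).
  by rewrite map_mx0 scaler0 addr0 map_row map_mx1.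
rewrite EX EY !(map_mxD, map_mxN, map_mxM) mulmxDl !mulmxDr.
rewrite -!scalemxAl -!scalemxAr scalerA -expr2 sqr_i scaleN1r scalerDr.
move: (map_mx _ X *m map_mx _ D1) (map_mx _ X *m map_mx _ D2).
move: (map_mx _ Y *m map_mx _ D1) (map_mx _ Y *m map_mx _ D2) => A B C D.
by apply/rowP => j; rewrite !mxE; ring.
Qed.

(* The linear system i a_j - sum_l a_l dphi_j/du_l = dphi_j (d/dzbar) that
   determines the d/du components a of Lb. *)
Definition udiff (phi : 'I_3 -> pt R -> R) (p : pt R) : 'M[R[i]]_3 :=
  \matrix_(l, j) ('i%C * (l == j)%:R - (pder (iu l) (phi j) p)%:C).

(** The left kernel of the 5 x 4 matrix [W] is a line, because [W] has rank 4, and it is spanned by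
    [Lb p]. A vector killed by [udiff], extended by zero in the x and y components, lies on that
    line; as [Lb p] has nonzero x component, the vector vanishes. *)
Lemma udiff_unit (phi : 'I_3 -> pt R -> R) (Lb : cvfield R) p :
  CR_generic_at phi p -> T01 phi p (Lb p) -> Lb p 0 ix = 2^-1 ->
  udiff phi p \in unitmx.
Proof.
move=> gen [c [cre cim]] Lx.
pose W := map_mx (real_complex R) (d_re p)
  + 'i%C *: map_mx (real_complex R) (d_im phi p).
have i2 : 'i%C * 'i%C = -1 :> R[i] by rewrite -expr2 sqr_i.
have WE l k : W l k = (d_re p l k)%:C + 'i%C * (d_im phi p l k)%:C.
  by rewrite !mxE.
have rW : \rank W = 4.
  by apply/eqP; exact: generic_row_full gen.
have LbW : Lb p *m W = 0.
  rewrite mulmxDr -scalemxAr cre cim scalerA mulrA i2 mulN1r scaleNr.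
  by rewrite subrr.
have Lb0 : Lb p != 0.
  apply/eqP => L0; move/eqP: Lx; rewrite L0 mxE eq_sym invr_eq0 pnatr_eq0 //.
have kerW : (kermx W <= Lb p)%MS.
  have : (Lb p <= kermx W)%MS by apply/sub_kermxP.
  move/mxrank_leqif_sup => [_ <-].
  by rewrite mxrank_ker rW rank_rV Lb0.
rewrite -row_free_unit; apply: inj_row_free => v vN.
pose Z : 'rV[R[i]]_5 := \row_(k < 5)
  if @fintype.split 2 3 k is inr j then v 0 j else 0.
have Zx : Z 0 ix = 0 by rewrite mxE; case: splitP.
have Zy : Z 0 iy = 0 by rewrite mxE; case: splitP.
have Zu j : Z 0 (iu j) = v 0 j by rewrite mxE (unsplitK (inr j)).
have ZW : Z *m W = 0.
  apply/rowP => k; rewrite [LHS]mxE sum_coords Zx Zy !mul0r !add0r [RHS]mxE.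
  under eq_bigr => j _ do rewrite Zu WE.
  case: (unliftP ord0 k) => [m ->|->]; last first.
    by apply: big1 => j _; rewrite d_re0 d_im0 !rmorph0 mulr0 addr0 mulr0.
  (* The u-rows of [W] in the columns of the w_j form -i times [udiff]. *)
  have := congr1 (fun N : 'rV_3 => - 'i%C * N 0 m) vN.
  rewrite !mxE mulr0 => E; rewrite -[RHS]E.
  rewrite mulr_sumr; apply: eq_bigr => j _; rewrite d_reS d_imS mxE.
  rewrite (inj_eq (@rshift_inj 2 3)) eq_sym rmorph_nat.
  rewrite mulrCA mulrBr; congr (_ * _).
  by rewrite mulrA mulNr i2 opprK mul1r mulNr opprK.
have /sub_rVP[a Za] : (Z <= Lb p)%MS.
  by apply: submx_trans kerW; apply/sub_kermxP.
have a0 : a = 0.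
  move: Zx; rewrite Za mxE Lx => /eqP; rewrite mulf_eq0 invr_eq0 pnatr_eq0 orbF.
  by move/eqP.
by apply/rowP => j; rewrite -Zu Za a0 scale0r !mxE.
Qed.

Lemma section_smooth (phi : 'I_3 -> pt R -> R) (Lb : cvfield R) :
  (forall j, smooth_on U (phi j)) ->
  (forall p, U p -> CR_generic_at phi p) ->
  normalized_T01_section U phi Lb -> vsmooth U Lb.
Proof.
move=> sphi gen sec.
pose c p : 'rV[R[i]]_3 := \row_j Lb p 0 (iu j).
pose v p : 'rV[R[i]]_3 := \row_j (2^-1 * (pder ix (phi j) p)%:C
  + 'i%C / 2 * (pder iy (phi j) p)%:C).
have sd k j : csmooth U (realf (pder k (phi j))).
  by apply: csmooth_realf => //; exact: smooth_on_pder.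
have su : forall j, csmooth U (fun p => c p 0 j).
  apply: (@csmooth_cramer _ _ oU _ (udiff phi) _ v) => [l j|j|p Up|p Up].
  - apply: (csmooth_congr oU) (csmoothD oU
      (csmooth_cst oU ('i%C * (l == j)%:R)) (csmoothN oU (sd (iu l) j))) => p _.
    by rewrite mxE.
  - apply: (csmooth_congr oU) (csmoothD oU
      (csmoothM oU (csmooth_cst oU 2^-1) (sd ix j))
      (csmoothM oU (csmooth_cst oU ('i%C / 2)) (sd iy j))) => p _.
    by rewrite mxE.
  - by have [T Lx Ly] := sec p Up; exact: udiff_unit (gen p Up) T Lx.
  (* In the column of w_j, the real part gives a_j = d_j / 2 and the imaginary part gives Lb(phi_j)
     = i d_j / 2. Eliminating d_j leaves Lb(phi_j) = i a_j, the required linear equation. *)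
  have [[d [dre dim]] Lx Ly] := sec p Up; apply/rowP => j.
  have := congr1 (fun N : 'rV_4 => N 0 (lift ord0 j)) dre.
  have := congr1 (fun N : 'rV_4 => N 0 (lift ord0 j)) dim.
  rewrite !mxE; under eq_bigr => l _ do rewrite mxE d_imS.
  under [in X in _ -> X -> _]eq_bigr => l _ do rewrite mxE d_reS.
  rewrite !sum_coords Lx Ly => E.
  rewrite (_ : (iu j == ix) = false) // (_ : (iu j == iy) = false) //.
  rewrite !rmorph0 !mulr0 !add0r (bigD1 j) //= eqxx big1 => [|l lj]; last first.
    by rewrite (inj_eq (@rshift_inj 2 3)) eq_sym (negbTE lj) rmorph0 mulr0.
  rewrite rmorph1 mulr1 addr0 => Lj.
  under eq_bigr => l _ do rewrite !mxE mulrBr.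
  rewrite sumrB (bigD1 j) //= eqxx big1 => [|l lj]; last first.
    by rewrite (negbTE lj) !mulr0.
  rewrite Lj !mulr1 addr0; apply/eqP; rewrite subr_eq E.
  by apply/eqP; ring.
move=> k; have [->|->|[j ->]] := coord_cases k.
- apply: (csmooth_congr oU) (csmooth_cst oU 2^-1) => p Up.
  by have [_ ->] := sec p Up.
- apply: (csmooth_congr oU) (csmooth_cst oU ('i%C / 2)) => p Up.
  by have [_ _ ->] := sec p Up.
- by apply: (csmooth_congr oU) (su j) => p Up; rewrite mxE.
Qed.

(** * Coefficients in the frame *)

Definition frame_mx (Lb : cvfield R) (p : pt R) : 'M[R[i]]_5 :=
  \matrix_i [:: vSb Lb p; vS Lb p; vT Lb p; Lb p; conjv Lb p]`_i.

Lemma frame_free (Lb : cvfield R) p : maximally_minimal U Lb -> U p ->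
  forall c : 'rV_5, c *m frame_mx Lb p = 0 -> c = 0.
Proof.
move=> mm Up c.
pose X := [tuple vSb Lb p; vS Lb p; vT Lb p; Lb p; conjv Lb p].
have /(@freeP _ _ _ X) fX : free X by exact: (basis_free (mm p Up)).
rewrite mulmx_sum_row => E; apply/rowP => i; rewrite [RHS]mxE.
by apply: (fX (fun i => c 0 i)); rewrite -[RHS]E; apply: eq_bigr => j _;
  rewrite rowK.
Qed.

(** The frame starts with [Sb], [S], [T], so the coefficients appear in reverse order; the default 0
    of [nth] supplies the components on [Lb] and its conjugate. *)
Lemma frame_comb (Lb : cvfield R) p (a b c : R[i]) :
  (\row_(i < 5) [:: c; b; a]`_i) *m frame_mx Lb p
    = a *: vT Lb p + b *: vS Lb p + c *: vSb Lb p.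
Proof.
rewrite mulmx_sum_row !big_ord_recl big_ord0 !rowK !mxE /= !scale0r !addr0.
by rewrite addrC [X in X + _]addrC.
Qed.

Lemma frame_coef_eq (Lb : cvfield R) p (a b c a' b' c' : R[i]) :
  maximally_minimal U Lb -> U p ->
  a *: vT Lb p + b *: vS Lb p + c *: vSb Lb p
    = a' *: vT Lb p + b' *: vS Lb p + c' *: vSb Lb p ->
  [/\ a = a', b = b' & c = c'].
Proof.
move=> mm Up; rewrite -!frame_comb => /eqP; rewrite -subr_eq0 -mulmxBl.
move=> /eqP/(frame_free mm Up)/rowP E.
have F i : [:: c; b; a]`_i = [:: c'; b'; a']`_i.
  have [i5|i5] := ltnP i 5; last by rewrite !nth_default // (leq_trans _ i5).
  by have /eqP := E (Ordinal i5); rewrite !mxE subr_eq0 => /eqP.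
by split; [have := F 2|have := F 1|have := F 0].
Qed.

Lemma frame_coef_smooth (Lb V : cvfield R) (a b c : cfun R) :
  vsmooth U Lb -> maximally_minimal U Lb -> vsmooth U V ->
  vsmooth U (vT Lb) -> vsmooth U (vS Lb) -> vsmooth U (vSb Lb) ->
  (forall p, U p -> V p = a p *: vT Lb p + b p *: vS Lb p + c p *: vSb Lb p) ->
  [/\ csmooth U a, csmooth U b & csmooth U c].
Proof.
move=> sLb mm sV sT sS sSb VE.
have sc : forall j : 'I_5, csmooth U
    (fun p => (\row_(i < 5) [:: c p; b p; a p]`_i) 0 j).
  apply: (@csmooth_cramer _ _ oU _ (frame_mx Lb) _ V) => // [i j|p Up|p Up].
  - apply: (csmooth_congr oU) (_ : csmooth U (fun p =>
      [:: vSb Lb p; vS Lb p; vT Lb p; Lb p; conjv Lb p]`_i 0 j)) => [p _|].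
      by rewrite mxE.
    case: i => [[|[|[|[|[|//]]]]] ?] /=; [exact: sSb|exact: sS|exact: sT| |].
      exact: sLb.
    exact: (vsmooth_conj oU sLb).
  - by rewrite -row_free_unit; apply: inj_row_free; exact: frame_free.
  - by rewrite frame_comb VE.
have H (i : 'I_5) f : (forall p, [:: c p; b p; a p]`_i = f p) -> csmooth U f.
  by move=> fE; apply: (csmooth_congr oU) (sc i) => p _; rewrite mxE.
split; [exact: (H (@Ordinal 5 2 isT))|exact: (H (@Ordinal 5 1 isT))|].
exact: (H (@Ordinal 5 0 isT)).
Qed.

End Frame.

(** * Brackets of the frame *)

(** Replaces values of derivatives and conjugates by variables, so that [ring] works on a plain
    polynomial identity. *)
Ltac atoms := repeat match goal with
  | |- context [vact ?X ?f ?p] => generalize (vact X f p); intro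
  | |- context [conjf ?f ?p] => generalize (conjf f p); intro
  end.

Ltac eval_at R p := repeat match goal with
  | |- context [(?f + ?g) p] => change ((f + g) p) with (f p + g p)
  | |- context [(- ?f) p] => change ((- f) p) with (- f p)
  | |- context [(?f * ?g) p] => change ((f * g) p) with (f p * g p)
  | |- context [(?f ^+ ?n) p] => change ((f ^+ n) p) with (f p ^+ n)
  | |- context [(?n%:R) p] => change ((n%:R) p) with (n%:R : R[i])
  end.

Lemma conj_iM (R : realType) (x : R[i]) :
  conjc ('i%C * x) = - 'i%C * conjc x.
Proof.
rewrite rmorphM; congr (_ * _).
by apply/eqP; rewrite eq_complex /= oppr0 !eqxx.
Qed.

Lemma scale_comb3 (K : pzRingType) (V : lmodType K) (k a b c : K) (t s u : V) :
  k *: (a *: t + b *: s + c *: u)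
    = (k * a) *: t + (k * b) *: s + (k * c) *: u.
Proof. by rewrite !scalerDr !scalerA. Qed.

Lemma conj_comb (R : realType) n (t s sb : 'rV[R[i]]_n) (a b c : R[i]) :
  map_mx conjc t = t -> map_mx conjc s = sb -> map_mx conjc sb = s ->
  map_mx conjc (- 'i%C *: (a *: t + b *: s + c *: sb))
    = 'i%C *: (conjc a *: t + conjc c *: s + conjc b *: sb).
Proof.
move=> tE sE sbE; rewrite map_mxZ !map_mxD !map_mxZ tE sE sbE addrAC.
congr (_ *: _).
by apply/eqP; rewrite eq_complex /= oppr0 opprK !eqxx.
Qed.

Section FundamentalBrackets.
Context (R : realType) (U : set (pt R)) (oU : open U).
Context (Lb : cvfield R) (sLb : vsmooth U Lb).

Local Notation L := (conjv Lb).
Local Notation T := (vT Lb).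
Local Notation S := (vS Lb).
Local Notation Sb := (vSb Lb).
Local Notation l := (vact (conjv Lb)).
Local Notation lb := (vact Lb).

Lemma conjvK (X : cvfield R) : conjv (conjv X) = X.
Proof.
by apply/funext => p; apply/rowP => k; rewrite !mxE; exact: conjcK.
Qed.

Lemma conjfK (f : cfun R) : conjf (conjf f) = f.
Proof. by apply/funext => p; exact: conjcK. Qed.

Let sL : vsmooth U L := vsmooth_conj oU sLb.

Lemma vT_smooth : vsmooth U T.
Proof.
by apply: vsmoothZ => //; [exact: csmooth_cst|exact: vsmooth_bracket].
Qed.

Lemma vS_smooth : vsmooth U S.
Proof. exact: (vsmooth_bracket oU sL vT_smooth). Qed.

Lemma vSb_smooth : vsmooth U Sb.
Proof. exact: (vsmooth_bracket oU sLb vT_smooth). Qed.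

Let sT := vT_smooth.
Let sS := vS_smooth.
Let sSb := vSb_smooth.

(** Conjugation exchanges L and Lb, which reverses the sign of their bracket, and it also reverses
    the sign of i. *)
Lemma vT_real p : U p -> conjv T p = T p.
Proof.
move=> Up; have E : vbracket Lb L p = conjv (vbracket L Lb) p.
  by rewrite -(vbracket_conj oU sL sLb Up) conjvK.
rewrite {2}/vT vbracketC E.
have H (V : 'rV[R[i]]_5) : map_mx conjc ('i%C *: V) = 'i%C *: - map_mx conjc V.
  apply/rowP => k; rewrite !mxE rmorphM mulrN -mulNr; congr (_ * _).
  by apply/eqP; rewrite eq_complex /= oppr0 !eqxx.
exact: H.
Qed.

Lemma vS_conj p : U p -> conjv S p = Sb p.
Proof.
move=> Up; rewrite -(vbracket_conj oU sL sT Up) conjvK.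
by apply: (vbracket_congr oU) Up => // q; exact: vT_real.
Qed.

Lemma vSb_conj p : U p -> conjv Sb p = S p.
Proof.
move=> Up; rewrite -(vbracket_conj oU sLb sT Up).
by apply: (vbracket_congr oU) Up => // q; exact: vT_real.
Qed.

Lemma vbracket_vT X p : vsmooth U X -> U p ->
  vbracket T X p = 'i%C *:
    (vbracket L (vbracket Lb X) p - vbracket Lb (vbracket L X) p).
Proof.
move=> sX Up; rewrite (vbracketZl oU 'i%C X (vsmooth_bracket oU sL sLb) Up).
by rewrite (vbracket_jacobi oU sL sLb sX Up).
Qed.

Lemma vact_vT f p : csmooth U f -> U p ->
  vact T f p = 'i%C * (l (lb f) p - lb (l f) p).
Proof. by move=> sf Up; rewrite vactZl (vact_bracket oU sL sLb sf Up). Qed.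

Lemma conj_l f p : csmooth U f -> U p -> conjc (l f p) = lb (conjf f) p.
Proof. by move=> sf Up; rewrite -(vact_conj _ sf Up) conjvK. Qed.

Lemma conj_lb f p : csmooth U f -> U p -> conjc (lb f p) = l (conjf f) p.
Proof. by move=> sf Up; rewrite -(vact_conj _ sf Up). Qed.

(** [A] is complex-valued with [conjf A = A], so that the five functions obey the same calculus. *)
Context (P Q Rf A B : cfun R).
Context (sP : csmooth U P) (sQ : csmooth U Q) (sR : csmooth U Rf).
Context (sA : csmooth U A) (sB : csmooth U B) (A_real : conjf A = A).
Context (LS : forall p, U p ->
  vbracket L S p = P p *: T p + Q p *: S p + Rf p *: Sb p).
Context (LbS : forall p, U p ->
  vbracket Lb S p = A p *: T p + B p *: S p + conjf B p *: Sb p).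
Context (LSb : forall p, U p ->
  vbracket L Sb p = A p *: T p + B p *: S p + conjf B p *: Sb p).
Context (LbSb : forall p, U p -> vbracket Lb Sb p =
  conjf P p *: T p + conjf Rf p *: S p + conjf Q p *: Sb p).

Local Notation Pb := (conjf P).
Local Notation Qb := (conjf Q).
Local Notation Rb := (conjf Rf).
Local Notation Bb := (conjf B).

(* The factor i is taken out of the coefficients below:
   [T, S] = i (TS_T T + TS_S S + TS_Sb Sb),
   [T, Sb] = - i (TSb_T T + TSb_S S + TSb_Sb Sb),
   [S, Sb] = - i (SSb_T T + SSb_S S + SSb_Sb Sb). *)
Definition TS_T : cfun R := l A + B * P + A * Bb - lb P - A * Q - Pb * Rf.
Definition TS_S : cfun R := A + l B + B * Bb - lb Q - Rf * Rb.
Definition TS_Sb : cfun R :=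
  l Bb + B * Rf + Bb * Bb - P - Bb * Q - Rf * Qb - lb Rf.

Definition TSb_T : cfun R := lb A + Bb * Pb + A * B - l Pb - A * Qb - P * Rb.
Definition TSb_Sb : cfun R := A + lb Bb + B * Bb - l Qb - Rf * Rb.
Definition TSb_S : cfun R :=
  lb B + Bb * Rb + B * B - Pb - B * Qb - Rb * Q - l Rb.

Ltac smooth := repeat match goal with
  | |- csmooth _ (_ + _) => apply: (csmoothD oU)
  | |- csmooth _ (- _) => apply: (csmoothN oU)
  | |- csmooth _ (_ * _) => apply: (csmoothM oU)
  | |- csmooth _ (vact (conjv Lb) _) => apply: (vact_smooth oU sL)
  | |- csmooth _ (vact Lb _) => apply: (vact_smooth oU sLb)
  | |- csmooth _ (conjf _) => apply: (csmooth_conj oU)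
  | |- _ => assumption
  end.

Lemma TS_TE p : TS_T p =
  l A p + B p * P p + A p * Bb p - lb P p - A p * Q p - Pb p * Rf p.
Proof. by []. Qed.

Lemma TS_SE p : TS_S p = A p + l B p + B p * Bb p - lb Q p - Rf p * Rb p.
Proof. by []. Qed.

Lemma TS_SbE p : TS_Sb p = l Bb p + B p * Rf p + Bb p * Bb p - P p - Bb p * Q p
  - Rf p * Qb p - lb Rf p.
Proof. by []. Qed.

Lemma TSb_TE p : TSb_T p =
  lb A p + Bb p * Pb p + A p * B p - l Pb p - A p * Qb p - P p * Rb p.
Proof. by []. Qed.

Lemma TSb_SbE p : TSb_Sb p =
  A p + lb Bb p + B p * Bb p - l Qb p - Rf p * Rb p.
Proof. by []. Qed.

Lemma TSb_SE p : TSb_S p = lb B p + Bb p * Rb p + B p * B p - Pb p - B p * Qb p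
  - Rb p * Q p - l Rb p.
Proof. by []. Qed.

Lemma smooth_coeffs : [/\ csmooth U TS_T, csmooth U TS_S & csmooth U TS_Sb] /\
  [/\ csmooth U TSb_T, csmooth U TSb_S & csmooth U TSb_Sb].
Proof.
by do 2!split; rewrite /TS_T /TS_S /TS_Sb /TSb_T /TSb_S /TSb_Sb; smooth.
Qed.

Ltac leibniz Up := repeat match goal with
  | |- context [vact ?X (?f + ?g) ?p] =>
      rewrite (_ : vact X (f + g) p = vact X f p + vact X g p);
        last by apply: vactD Up; smooth
  | |- context [vact ?X (- ?f) ?p] =>
      rewrite (_ : vact X (- f) p = - vact X f p);
        last by apply: (vactN oU) Up; smooth
  | |- context [vact ?X (?f * ?g) ?p] =>
      rewrite (_ : vact X (f * g) p = f p * vact X g p + g p * vact X f p);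
        last by apply: vactM Up; smooth
  end.

(** This and the next three lemmas expand the derivatives that occur in a + conj a and b + conj c;
    the formulas for J and K are stated in expanded form. *)
Lemma lb_TS_T p : U p -> lb TS_T p =
  lb (l A) p + (B p * lb P p + P p * lb B p) + (A p * lb Bb p + Bb p * lb A p)
  - lb (lb P) p - (A p * lb Q p + Q p * lb A p)
  - (Pb p * lb Rf p + Rf p * lb Pb p).
Proof. by move=> Up; rewrite /TS_T; leibniz Up. Qed.

Lemma l_TSb_T p : U p -> l TSb_T p =
  l (lb A) p + (Bb p * l Pb p + Pb p * l Bb p) + (A p * l B p + B p * l A p)
  - l (l Pb) p - (A p * l Qb p + Qb p * l A p) - (P p * l Rb p + Rb p * l P p).
Proof. by move=> Up; rewrite /TSb_T; leibniz Up. Qed.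

Lemma lb_TS_S p : U p -> lb TS_S p =
  lb A p + lb (l B) p + (B p * lb Bb p + Bb p * lb B p) - lb (lb Q) p
  - (Rf p * lb Rb p + Rb p * lb Rf p).
Proof. by move=> Up; rewrite /TS_S; leibniz Up. Qed.

Lemma l_TSb_S p : U p -> l TSb_S p =
  l (lb B) p + (Bb p * l Rb p + Rb p * l Bb p) + (B p * l B p + B p * l B p)
  - l Pb p - (B p * l Qb p + Qb p * l B p) - (Rb p * l Q p + Q p * l Rb p)
  - l (l Rb) p.
Proof. by move=> Up; rewrite /TSb_S; leibniz Up. Qed.

(* Otherwise unification unfolds these sums when rewriting. *)
#[local] Opaque TS_T TS_S TS_Sb TSb_T TSb_S TSb_Sb.

(** * The brackets [T, S], [T, Sb] and [S, Sb] *)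

Lemma vbracket_TS p : U p -> vbracket T S p =
  'i%C *: (TS_T p *: T p + TS_S p *: S p + TS_Sb p *: Sb p).
Proof.
move=> Up; rewrite (vbracket_vT sS Up); congr (_ *: _).
rewrite (vbracket_congr oU (fun _ _ => erefl) LbS Up).
rewrite (vbracket_congr oU (X' := Lb) (fun _ _ => erefl) LS Up).
rewrite !(vbracket_comb3 oU) //; try by smooth.
(* The Leibniz rule leaves [L, T] and [Lb, T], which are [S] and [Sb] by definition. *)
rewrite -/(S p) -/(Sb p) LS // LSb // LbS // LbSb //.
rewrite TS_TE TS_SE TS_SbE; atoms.
move: (T p) (S p) (Sb p) => *.
by apply/rowP => k; rewrite !mxE; ring.
Qed.

Lemma vbracket_TSb p : U p -> vbracket T Sb p =
  - 'i%C *: (TSb_T p *: T p + TSb_S p *: S p + TSb_Sb p *: Sb p).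
Proof.
move=> Up; rewrite (vbracket_vT sSb Up) scaleNr -scalerN; congr (_ *: _).
rewrite (vbracket_congr oU (fun _ _ => erefl) LbSb Up).
rewrite (vbracket_congr oU (X' := Lb) (fun _ _ => erefl) LSb Up).
rewrite !(vbracket_comb3 oU) //; try by smooth.
rewrite -/(S p) -/(Sb p) LS // LSb // LbS // LbSb //.
rewrite TSb_TE TSb_SE TSb_SbE; atoms.
move: (T p) (S p) (Sb p) => *.
by apply/rowP => k; rewrite !mxE; ring.
Qed.

(** Coefficients of [L, [T, Sb]] - [T, [L, Sb]], with -i taken out. The commutators l lb - lb l are
    -i times the derivatives along T of A, B, conj B; [TSb_T] reappears in [SSb_S] because [L, T] =
    S, and [T, T] contributes nothing. *)
Definition SSb_T : cfun R := l TSb_T + TSb_S * P + TSb_Sb * A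
  + (l (lb A) - lb (l A)) + B * TS_T - Bb * TSb_T.
Definition SSb_S : cfun R := TSb_T + l TSb_S + TSb_S * Q + TSb_Sb * B
  + (l (lb B) - lb (l B)) + B * TS_S - Bb * TSb_S.
Definition SSb_Sb : cfun R := l TSb_Sb + TSb_S * Rf + TSb_Sb * Bb
  + (l (lb Bb) - lb (l Bb)) + B * TS_Sb - Bb * TSb_Sb.

Lemma SSb_TE p : SSb_T p = l TSb_T p + TSb_S p * P p + TSb_Sb p * A p
  + (l (lb A) p - lb (l A) p) + B p * TS_T p - Bb p * TSb_T p.
Proof. by []. Qed.

Lemma SSb_SE p : SSb_S p = TSb_T p + l TSb_S p + TSb_S p * Q p
  + TSb_Sb p * B p + (l (lb B) p - lb (l B) p) + B p * TS_S p - Bb p * TSb_S p.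
Proof. by []. Qed.

Lemma SSb_SbE p : SSb_Sb p = l TSb_Sb p + TSb_S p * Rf p + TSb_Sb p * Bb p
  + (l (lb Bb) p - lb (l Bb) p) + B p * TS_Sb p - Bb p * TSb_Sb p.
Proof. by []. Qed.

#[local] Opaque SSb_T SSb_S SSb_Sb.

Lemma vbracket_SSb p : U p -> vbracket S Sb p =
  - 'i%C *: (SSb_T p *: T p + SSb_S p *: S p + SSb_Sb p *: Sb p).
Proof.
move=> Up; rewrite (vbracket_jacobi oU sL sT sSb Up).
rewrite (vbracket_congr oU (fun _ _ => erefl) vbracket_TSb Up).
rewrite (vbracket_congr oU (X' := T) (fun _ _ => erefl) LSb Up).
have [_ [sTSb_T sTSb_S sTSb_Sb]] := smooth_coeffs.
have sBb : csmooth U Bb by smooth.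
rewrite (vbracketZ oU L (csmooth_cst oU (- 'i%C))) ?vact_cst //; last first.
  by do 2?apply: (vsmoothD oU); apply: (vsmoothZ oU).
rewrite !(vbracket_comb3 oU) //.
have TT : vbracket T T p = 0 by apply/rowP => k; rewrite !mxE subrr.
rewrite -/(S p) LS // LSb // vbracket_TS // vbracket_TSb // TT !vact_vT //.
rewrite SSb_TE SSb_SE SSb_SbE; atoms.
move: (TS_T p) (TS_S p) (TS_Sb p) (TSb_T p) (TSb_S p) (TSb_Sb p) => *.
move: (T p) (S p) (Sb p) 'i%C (A p) (B p) (P p) (Q p) (Rf p) => *.
apply/rowP => k; rewrite !mxE.
move: (fun_of_matrix _ _ k) (fun_of_matrix _ _ k) (fun_of_matrix _ _ k) => *.
by ring.
Qed.

(** * Conjugation symmetries and the doubled coefficients *)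

Lemma TS_conj p : U p -> [/\ conjf TS_T p = TSb_T p,
  conjf TS_S p = TSb_Sb p & conjf TS_Sb p = TSb_S p].
Proof.
move=> Up; have sBb : csmooth U Bb by smooth.
have conjfE f : conjf f p = conjc (f p) by [].
have Ap : conjc (A p) = A p by rewrite -conjfE A_real.
rewrite !conjfE TS_TE TS_SE TS_SbE TSb_TE TSb_SE TSb_SbE.
rewrite !(rmorphB, rmorphD, rmorphM) /=.
rewrite !conj_l // !conj_lb // A_real conjfK !conjfE !conjcK Ap.
by atoms; split; ring.
Qed.

Lemma TSb_conj p : U p -> [/\ conjf TSb_T p = TS_T p,
  conjf TSb_Sb p = TS_S p & conjf TSb_S p = TS_Sb p].
Proof.
by move=> Up; have [E1 E2 E3] := TS_conj Up; split;
  rewrite {1}/conjf -(E1, E2, E3) conjcK.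
Qed.

(** Conjugation exchanges l with lb and the [TS] coefficients with the [TSb] ones, and it reverses
    the commutators. Hence the last three terms are opposite to those of [SSb_T] and [SSb_S], and
    cancel in the two sums computed below. *)
Lemma SSb_conj p : U p -> [/\
  conjf SSb_T p = lb TS_T p + TS_Sb p * Pb p + TS_S p * A p
    + (lb (l A) p - l (lb A) p) + Bb p * TSb_T p - B p * TS_T p &
  conjf SSb_Sb p = lb TS_S p + TS_Sb p * Rb p + TS_S p * B p
    + (lb (l B) p - l (lb B) p) + Bb p * TSb_S p - B p * TS_S p].
Proof.
move=> Up; have sBb : csmooth U Bb by smooth.
have [[sT1 sT2 sT3] [sT4 sT5 sT6]] := smooth_coeffs.
have conjfE f : conjf f p = conjc (f p) by [].
have Ap : conjc (A p) = A p by rewrite -conjfE A_real.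
have [cTb cSbb cSb] := TSb_conj Up.
rewrite !conjfE in cTb cSbb cSb.
have [cT cS cSb'] := TS_conj Up.
have conj_ll X f : csmooth U f -> vsmooth U X ->
    conjc (vact X (lb f) p) = vact (conjv X) (l (conjf f)) p.
  move=> sf sX; rewrite -(vact_conj _ (vact_smooth oU sLb sf) Up).
  by apply: (vact_congr oU) Up => // q Uq; exact: conj_lb.
have conj_ll' X f : csmooth U f -> vsmooth U X ->
    conjc (vact X (l f) p) = vact (conjv X) (lb (conjf f)) p.
  move=> sf sX; rewrite -(vact_conj _ (vact_smooth oU sL sf) Up).
  by apply: (vact_congr oU) Up => // q Uq; exact: conj_l.
have lTb : conjc (l TSb_T p) = lb TS_T p.
  rewrite conj_l //; apply: (vact_congr oU) Up => // q Uq.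
  by have [] := TSb_conj Uq.
have lSbb : conjc (l TSb_Sb p) = lb TS_S p.
  rewrite conj_l //; apply: (vact_congr oU) Up => // q Uq.
  by have [] := TSb_conj Uq.
have llA : conjc (l (lb A) p) = lb (l A) p.
  by move: (conj_ll _ _ sA sL); rewrite conjvK A_real.
have lblA : conjc (lb (l A) p) = l (lb A) p.
  by move: (conj_ll' _ _ sA sLb); rewrite A_real.
have llB : conjc (l (lb Bb) p) = lb (l B) p.
  by move: (conj_ll _ _ sBb sL); rewrite conjvK conjfK.
have lblB : conjc (lb (l Bb) p) = l (lb B) p.
  by move: (conj_ll' _ _ sBb sLb); rewrite conjfK.
have BbE : conjc (Bb p) = B p by exact: conjcK.
(* The equations return to the goal so that [atoms] renames the same values in them and in the goal;
   rewriting with them then carries out the conjugation. *)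
move: lTb lSbb llA lblA llB lblB cTb cSb cSbb BbE cT cS cSb'.
rewrite !conjfE SSb_TE SSb_SbE conjfE; atoms.
move: (TS_T p) (TS_S p) (TS_Sb p) (TSb_T p) (TSb_S p) (TSb_Sb p) Ap.
move: (A p) (B p) (P p) (Rf p) => ? ? ? ? ? ? ? ? ? ? Ap.
move=> lTb lSbb llA lblA llB lblB cTb cSb cSbb BbE cT cS cSb'.
rewrite !(rmorphB, rmorphD, rmorphM) /=.
by rewrite lTb lSbb llA lblA llB lblB cTb cSb cSbb Ap
  cT cSb' ?conjcK; split.
Qed.

Lemma SSb_T_double p : U p -> SSb_T p + conjf SSb_T p =
  (- lb (lb P) + lb (l A) + l (lb A) - l (l Pb)
   - Q * lb A - 2 * A * lb Q - Rf * lb Pb - 2 * Pb * lb Rf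
   - 2 * A * Rf * Rb - 2 * P * Pb - Bb * Pb * Q - Pb * Qb * Rf
   - Rb * l P - 2 * P * l Rb - Qb * l A - 2 * A * l Qb
   - P * Q * Rb - B * P * Qb
   + 2 * P * lb B + B * lb P + 2 * A * lb Bb + Bb * lb A
   + 2 * A * l B + 2 * A ^+ 2 + 2 * A * B * Bb + 2 * Pb * l Bb
   + B * Pb * Rf + Bb ^+ 2 * Pb + B * l A + Bb * l Pb
   + B ^+ 2 * P + Bb * P * Rb) p.
Proof.
move=> Up; have [-> _] := SSb_conj Up; eval_at R p.
rewrite SSb_TE l_TSb_T // lb_TS_T // TS_TE TS_SE TS_SbE TSb_TE TSb_SE TSb_SbE.
atoms.
move: (A p) (B p) (P p) (Q p) (Rf p) => *.
by ring.
Qed.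

Lemma SSb_S_double p : U p -> SSb_S p + conjf SSb_Sb p =
  (- lb (lb Q) + lb (l B) + l (lb B) - l (l Rb)
   - 2 * Rb * lb Rf - Rf * lb Rb - B * lb Q - B * Rf * Rb
   - 2 * P * Rb - Qb * Rf * Rb - 2 * l Pb - Rb * l Q
   - 2 * Q * l Rb - Qb * l B - 2 * B * l Qb - A * Qb - Pb * Q
   - Q ^+ 2 * Rb - B * Q * Qb
   + 2 * lb A + Bb * lb B + 2 * B * lb Bb + 3 * B * l B
   + 3 * A * B + B ^+ 2 * Q + 2 * B ^+ 2 * Bb + 2 * Rb * l Bb
   + Bb ^+ 2 * Rb + Bb * l Rb + Bb * Pb + Q * lb B) p.
Proof.
move=> Up; have [_ ->] := SSb_conj Up; eval_at R p.
rewrite SSb_SE l_TSb_S // lb_TS_S // TS_SE TS_SbE TSb_TE TSb_SE TSb_SbE.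
atoms.
move: (A p) (B p) (P p) (Q p) (Rf p) => *.
by ring.
Qed.

Lemma SSb_coeffs p : maximally_minimal U Lb -> U p ->
  [/\ conjf SSb_T p = SSb_T p, conjf SSb_S p = SSb_Sb p
     & conjf SSb_Sb p = SSb_S p].
Proof.
move=> mm Up.
have E : vbracket Sb S p = map_mx conjc (vbracket S Sb p).
  rewrite -[RHS]/(conjv (vbracket S Sb) p) -(vbracket_conj oU sS sSb Up).
  apply/esym.
  by apply: (vbracket_congr oU) Up; [exact: vS_conj|exact: vSb_conj].
move: E; rewrite vbracketC (vbracket_SSb Up) conj_comb; last 3 first.
- exact: vT_real.
- exact: vS_conj.
- exact: vSb_conj.
(* Both sides are now i times a combination of [T], [S], [Sb], and the freeness of the frame allows
   the coefficients to be compared. *)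
rewrite scaleNr opprK => E.
have i0 : 'i%C != 0 :> R[i] by rewrite eq_complex /= oner_eq0 andbF.
by have [? ? ?] := frame_coef_eq mm Up (scalerI i0 E); split; apply/esym.
Qed.

End FundamentalBrackets.

Theorem lemma1p7 (R : realType) (U : set 'rV[R]_5)
    (phi : 'I_3 -> 'rV[R]_5 -> R) (Lb : 'rV[R]_5 -> 'rV[R[i]]_5)
    (P Q Rf : 'rV[R]_5 -> R[i]) (A0 : 'rV[R]_5 -> R) (B : 'rV[R]_5 -> R[i])
    (U_open : open U) (U_0 : U 0)
    (phi_analytic : forall j, real_analytic_on U (phi j))
    (phi_0 : forall j, phi j 0 = 0)
    (dphi_0 : forall j (h : 'rV[R]_5), 'd (phi j) (0 : 'rV[R]_5) h = 0)
    (M_generic : forall p, U p -> CR_generic_at phi p)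
    (Lb_section : normalized_T01_section U phi Lb)
    (M_maxmin : maximally_minimal U Lb)
    (fund : fundamental_functions U Lb P Q Rf A0 B) :
  let T := vT Lb in let S := vS Lb in let Sb := vSb Lb in
  let l := vact (conjv Lb) in let lb := vact Lb in
  let i : 'rV[R]_5 -> R[i] := cst 'i%C in
  let A := realf A0 in
  let Pb := conjf P in let Qb := conjf Q in
  let Rb := conjf Rf in let Bb := conjf B in
  exists (E F G K : 'rV[R]_5 -> R[i]) (J : 'rV[R]_5 -> R), forall p, U p ->
  [/\ vbracket T S p = E p *: T p + F p *: S p + G p *: Sb p,
      vbracket T Sb p =
        conjf E p *: T p + conjf G p *: S p + conjf F p *: Sb p &
      vbracket S Sb p =
        ('i%C * realf J p) *: T p + K p *: S p - conjf K p *: Sb p]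
  /\
  [/\ E p = (- i * lb P - i * A * Q - i * Pb * Rf + i * l A + i * B * P
             + i * A * Bb) p,
      F p = (- i * lb Q - i * Rf * Rb + i * A + i * l B + i * B * Bb) p,
      G p = (- i * P - i * Bb * Q - i * Rf * Qb - i * lb Rf + i * B * Rf
             + i * Bb * Bb + i * l Bb) p,
      - 2 * realf J p =
        (- lb (lb P) + lb (l A) + l (lb A) - l (l Pb)
         - Q * lb A - 2 * A * lb Q - Rf * lb Pb - 2 * Pb * lb Rf
         - 2 * A * Rf * Rb - 2 * P * Pb - Bb * Pb * Q - Pb * Qb * Rf
         - Rb * l P - 2 * P * l Rb - Qb * l A - 2 * A * l Qb
         - P * Q * Rb - B * P * Qb
         + 2 * P * lb B + B * lb P + 2 * A * lb Bb + Bb * lb A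
         + 2 * A * l B + 2 * A ^+ 2 + 2 * A * B * Bb + 2 * Pb * l Bb
         + B * Pb * Rf + Bb ^+ 2 * Pb + B * l A + Bb * l Pb
         + B ^+ 2 * P + Bb * P * Rb) p &
      2 * 'i%C * K p =
        (- lb (lb Q) + lb (l B) + l (lb B) - l (l Rb)
         - 2 * Rb * lb Rf - Rf * lb Rb - B * lb Q - B * Rf * Rb
         - 2 * P * Rb - Qb * Rf * Rb - 2 * l Pb - Rb * l Q
         - 2 * Q * l Rb - Qb * l B - 2 * B * l Qb - A * Qb - Pb * Q
         - Q ^+ 2 * Rb - B * Q * Qb
         + 2 * lb A + Bb * lb B + 2 * B * lb Bb + 3 * B * l B
         + 3 * A * B + B ^+ 2 * Q + 2 * B ^+ 2 * Bb + 2 * Rb * l Bb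
         + Bb ^+ 2 * Rb + Bb * l Rb + Bb * Pb + Q * lb B) p].

Proof.
cbv zeta; set T := vT Lb; set S := vS Lb; set Sb := vSb Lb; set A := realf A0.
have sphi j : smooth_on U (phi j) by have [] := phi_analytic j.
have sLb : vsmooth U Lb := section_smooth U_open sphi M_generic Lb_section.
have sT := vT_smooth U_open sLb.
have sS := vS_smooth U_open sLb.
have sSb := vSb_smooth U_open sLb.
have sL := vsmooth_conj U_open sLb.
have LS p : U p ->
    vbracket (conjv Lb) S p = P p *: T p + Q p *: S p + Rf p *: Sb p.
  by move=> /fund[].
have LbS p : U p ->
    vbracket Lb S p = A p *: T p + B p *: S p + conjf B p *: Sb p.
  by move=> /fund[].
have LSb p : U p ->
    vbracket (conjv Lb) Sb p = A p *: T p + B p *: S p + conjf B p *: Sb p.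
  by move=> /fund[].
have LbSb p : U p ->
    vbracket Lb Sb p = conjf P p *: T p + conjf Rf p *: S p + conjf Q p *: Sb p.
  by move=> /fund[].
(* The brackets [L, S] and [Lb, S] together display all five fundamental functions. *)
have [sP sQ sR] := frame_coef_smooth U_open sLb M_maxmin
  (vsmooth_bracket U_open sL sS) sT sS sSb LS.
have [sA sB _] := frame_coef_smooth U_open sLb M_maxmin
  (vsmooth_bracket U_open sLb sS) sT sS sSb LbS.
have A_real : conjf A = A by apply/funext => p; exact: conjc_real.
pose e := TS_T Lb P Q Rf A B; pose f := TS_S Lb Q Rf A B.
pose g := TS_Sb Lb P Q Rf B.
pose a := SSb_T Lb P Q Rf A B; pose b := SSb_S Lb P Q Rf A B.
exists (fun p => 'i%C * e p), (fun p => 'i%C * f p), (fun p => 'i%C * g p).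
(* From [S, Sb] = -i (a T + b S + c Sb) one reads K = -i b and J = -a; the real part makes J a real
   function, and [aJ] recovers -a on [U], where a is real. *)
exists (fun p => - 'i%C * b p), (fun p => - complex.Re (a p)) => p Up.
have [ca cb cc] := SSb_coeffs U_open sLb sP sQ sR sA sB LS LbS LSb LbSb
  M_maxmin Up.
have [ce cf cg] := TS_conj U_open Lb sP sQ sR sA sB A_real Up.
have aJ : realf (fun p => - complex.Re (a p)) p = - a p.
  move: ca; rewrite /realf /conjf -/a rmorphN /=; case: (a p) => x y [yE].
  have y0 : y = 0 by lra.
  by apply/eqP; rewrite eq_complex /= y0 oppr0 !eqxx.
have ii : 'i%C * - 'i%C = 1 :> R[i] by rewrite mulrN -expr2 sqr_i opprK.
split; split.
- rewrite (vbracket_TS U_open sLb sP sQ sR sA sB LS LbS LSb LbSb Up).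
  exact: scale_comb3.
- rewrite (vbracket_TSb U_open sLb sP sQ sR sA sB LS LbS LSb LbSb Up).
  rewrite -ce -cf -cg scale_comb3.
  by congr (_ *: _ + _ *: _ + _ *: _); apply/esym/conj_iM.
- rewrite (vbracket_SSb U_open sLb sP sQ sR sA sB LS LbS LSb LbSb Up).
  (* With c = conj b, the last coefficient -i c is -conj K. *)
  rewrite aJ -cb scale_comb3 -scaleNr.
  congr (_ *: _ + _ *: _ + _ *: _); first by rewrite mulrN mulNr.
  have -> : conjf (fun p => - 'i%C * b p) p = - conjc ('i%C * b p).
    by rewrite {1}/conjf mulNr rmorphN.
  by rewrite conj_iM opprK.
- rewrite /e TS_TE; eval_at R p; rewrite -[cst _ p]/('i%C); atoms.
  by move: 'i%C (A p) (B p) (P p) (Q p) (Rf p) => *; ring.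
- rewrite /f TS_SE; eval_at R p; rewrite -[cst _ p]/('i%C); atoms.
  by move: 'i%C (A p) (B p) (P p) (Q p) (Rf p) => *; ring.
- rewrite /g TS_SbE; eval_at R p; rewrite -[cst _ p]/('i%C); atoms.
  by move: 'i%C (A p) (B p) (P p) (Q p) (Rf p) => *; ring.
(* Here -2J = 2a = a + conj a; in the next case 2iK = 2b = b + conj c. *)
- rewrite aJ -(SSb_T_double U_open sLb sP sQ sR sA sB A_real Up) ca -/a.
  by move: (a p) => x; ring.
- rewrite -(SSb_S_double U_open sLb sP sQ sR sA sB A_real Up) cc -/b.
  by rewrite mulrA -(mulrA 2) ii mulr1; move: (b p) => x; ring.
Qed.
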